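(* Let $\mathfrak g$ be a complex simple Lie algebra of rank $\ge3$. There is a right action of $SL_2(\mathbb C)$ on $D_\lambda(\mathfrak g)$ (by $\mathbb C[\lambda]$-algebra automorphisms). For $A=\begin{pmatrix} a_{11} & a_{12} \\ {} a_{21} & a_{22} \end{pmatrix}\in SL_2(\mathbb C)$ and $z\in\mathfrak g$, the action is given by $$z\mapsto z,\qquad K(z)\mapsto a_{11}K(z)+a_{12}Q(z),\qquad Q(z)\mapsto a_{22}Q(z)+a_{21}K(z),$$ $$P(z)\mapsto(a_{11}a_{22}+a_{12}a_{21})P(z)+a_{11}a_{21}[K(y),K(w)]+a_{12}a_{22}[Q(y),Q(w)]\quad\text{where } z=[y,w]$$ (extended linearly in $z$). In particular, there is an order 4 automorphism of $D_\lambda(\mathfrak g)$: $z\mapsto z$, $K(z)\mapsto-Q(z)$, $Q(z)\mapsto K(z)$, $P(z)\mapsto-P(z)$.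
   Context: $\Phi$ is the root system of $\mathfrak g$ with respect to a Cartan subalgebra, $(\cdot,\cdot)$ the invariant form on $\mathfrak g$ normalized so that long roots have squared length $2$, $X_\alpha\in\mathfrak g_\alpha$ with $(X_\alpha,X_{-\alpha})=1$, $S(a,b)=ab+ba$. $D_\lambda(\mathfrak g)$ is the unital associative $\mathbb C[\lambda]$-algebra generated by $X,K(X),Q(X),P(X)$ ($X\in\mathfrak g$), such that: $X\mapsto X$, $X\otimes v\mapsto K(X)$ extend to an algebra map $U(\mathfrak g[v])\to D_\lambda(\mathfrak g)$; $X\mapsto X$, $X\otimes u\mapsto Q(X)$ extend to an algebra map $U(\mathfrak g[u])\to D_\lambda(\mathfrak g)$; $P(X)$ is linear in $X$ and $[X,P(X')]=P([X,X'])$ for $X,X'\in\mathfrak g$; and for all root vectors $X_{\beta_1},X_{\beta_2}$ with $\beta_1\ne-\beta_2$, $$[K(X_{\beta_1}),Q(X_{\beta_2})]=P([X_{\beta_1},X_{\beta_2}])-\lambda\tfrac{(\beta_1,\beta_2)}{4}S(X_{\beta_1},X_{\beta_2})+\tfrac{\lambda}{4}\sum_{\alpha\in\Phi}S([X_{\beta_1},X_\alpha],[X_{-\alpha},X_{\beta_2}]).$$ Note $[K(y),K(w)]$ and $[Q(y),Q(w)]$ are the images of $[y,w]\otimes v^2$ and $[y,w]\otimes u^2$, so depend only on $[y,w]$. *)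

(* Defs.v *)
From HB Require Import structures.
From mathcomp Require Import all_boot all_order all_algebra.
From mathcomp Require Import generic_quotient.
From mathcomp.real_closed Require Import complex.
From mathcomp Require Import finmap boolp classical_sets functions cardinality reals.

Set Implicit Arguments.
Unset Strict Implicit.
Unset Printing Implicit Defensive.

Import Order.TTheory GRing.Theory Num.Theory.
Local Open Scope ring_scope.
Local Open Scope quotient_scope.

Definition commutator (A : pzRingType) (a b : A) : A := a * b - b * a.

Definition anticommutator (A : pzRingType) (a b : A) : A := a * b + b * a.

(** A presentation over [R] with generators [G] is a class of assignments
  [f : G -> A] of the generators into (nonzero) [R]-algebras.  The presented
  algebra is the quotient of the expressions in the generators that identifies
  two of them when they agree under all the assignments of the class.  The
  condition [holds0] says that sending every generator to 0 belongs to the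
  class; it makes the presented algebra nonzero. *)

Record presentation (R : comNzRingType) (G : Type) := Presentation {
  holds : forall A : algType R, (G -> A) -> Prop;
  holds0 : @holds R^o (fun=> 0) }.

Section PresentedAlgebra.
Variables (R : comNzRingType) (G : Type).

Inductive expr :=
  | Gen of G
  | Const of R
  | Add of expr & expr
  | Mul of expr & expr.

HB.instance Definition _ := gen_eqMixin expr.
HB.instance Definition _ := gen_choiceMixin expr.

Fixpoint eval (A : algType R) (f : G -> A) (e : expr) : A :=
  match e with
  | Gen x => f x
  | Const c => c%:A
  | Add e1 e2 => eval f e1 + eval f e2
  | Mul e1 e2 => eval f e1 * eval f e2
  end.

Variable P : presentation R G.

Definition expr_eq (e1 e2 : expr) : bool :=
  `[< forall (A : algType R) (f : G -> A), holds P f -> eval f e1 = eval f e2 >].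

Fact expr_eq_refl : reflexive expr_eq. Proof. by move=> e; apply/asboolP. Qed.

Fact expr_eq_sym : symmetric expr_eq.
Proof.
by move=> d e; apply/asboolP/asboolP => h A f hf; rewrite (h A f hf).
Qed.

Fact expr_eq_trans : transitive expr_eq.
Proof.
move=> e d c /asboolP h1 /asboolP h2; apply/asboolP => A f hf.
by rewrite (h1 A f hf) (h2 A f hf).
Qed.

Canonical expr_equiv := EquivRel expr_eq expr_eq_refl expr_eq_sym expr_eq_trans.

Definition presented : Type := {eq_quot expr_equiv}.

HB.instance Definition _ := Choice.on presented.

Definition cls (e : expr) : presented := \pi_({eq_quot expr_equiv}) e.

Definition gen (x : G) : presented := cls (Gen x).

Definition lift (A : algType R) (f : G -> A) (_ : holds P f) (x : presented) : A :=
  eval f (repr (x : {eq_quot expr_equiv})).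

Fact lift_cls (A : algType R) (f : G -> A) (hf : holds P f) e :
  lift hf (cls e) = eval f e.
Proof.
rewrite /lift /cls; case: piP => e' /eqmodP /asboolP h.
by rewrite (h A f hf).
Qed.

Fact presented_ext (x y : presented) :
  (forall (A : algType R) (f : G -> A) (hf : holds P f), lift hf x = lift hf y) ->
  x = y.
Proof.
move=> h; rewrite -[x](reprK (x : {eq_quot expr_equiv})).
rewrite -[y](reprK (y : {eq_quot expr_equiv})).
by apply/eqmodP/asboolP => A f hf; have := h A f hf.
Qed.

Definition presented_const (c : R) : presented := cls (Const c).
Definition presented_add (x y : presented) : presented :=
  cls (Add (repr x) (repr y)).
Definition presented_mul (x y : presented) : presented :=
  cls (Mul (repr x) (repr y)).
Definition presented_scale (c : R) : presented -> presented :=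
  presented_mul (presented_const c).

Fact lift_const (A : algType R) f (hf : holds P f) c :
  lift hf (presented_const c) = c%:A :> A.
Proof. by rewrite lift_cls. Qed.

Fact lift_add (A : algType R) f (hf : holds P f) x y :
  lift hf (presented_add x y) = lift hf x + lift hf y :> A.
Proof. by rewrite lift_cls. Qed.

Fact lift_mul (A : algType R) f (hf : holds P f) x y :
  lift hf (presented_mul x y) = lift hf x * lift hf y :> A.
Proof. by rewrite lift_cls. Qed.

Fact lift_scale (A : algType R) f (hf : holds P f) c x :
  lift hf (presented_scale c x) = c *: lift hf x :> A.
Proof. by rewrite lift_mul lift_const mulr_algl. Qed.

Let liftE := (lift_const, lift_add, lift_mul, lift_scale).

Fact presented_addA : associative presented_add.
Proof. by move=> x y z; apply: presented_ext => A f hf; rewrite !liftE addrA. Qed.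
Fact presented_addC : commutative presented_add.
Proof. by move=> x y; apply: presented_ext => A f hf; rewrite !liftE addrC. Qed.
Fact presented_add0 : left_id (presented_const 0) presented_add.
Proof. by move=> x; apply: presented_ext => A f hf; rewrite !liftE scale0r add0r. Qed.
Fact presented_addN :
  left_inverse (presented_const 0) (presented_scale (-1)) presented_add.
Proof.
by move=> x; apply: presented_ext => A f hf; rewrite !liftE scale0r scaleN1r addNr.
Qed.

HB.instance Definition _ := GRing.isZmodule.Build presented
  presented_addA presented_addC presented_add0 presented_addN.

Fact presented_mulA : associative presented_mul.
Proof. by move=> x y z; apply: presented_ext => A f hf; rewrite !liftE mulrA. Qed.
Fact presented_mul1 : left_id (presented_const 1) presented_mul.
Proof. by move=> x; apply: presented_ext => A f hf; rewrite !liftE scale1r mul1r. Qed.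
Fact presented_mulr1 : right_id (presented_const 1) presented_mul.
Proof. by move=> x; apply: presented_ext => A f hf; rewrite !liftE scale1r mulr1. Qed.
Fact presented_mulDl : left_distributive presented_mul +%R.
Proof. by move=> x y z; apply: presented_ext => A f hf; rewrite !liftE mulrDl. Qed.
Fact presented_mulDr : right_distributive presented_mul +%R.
Proof. by move=> x y z; apply: presented_ext => A f hf; rewrite !liftE mulrDr. Qed.
Fact presented_1neq0 : presented_const 1 != 0.
Proof.
apply/eqP => /(congr1 (lift (holds0 P))); rewrite !lift_const scale1r scale0r.
by apply/eqP/oner_neq0.
Qed.

HB.instance Definition _ := GRing.Zmodule_isNzRing.Build presented
  presented_mulA presented_mul1 presented_mulr1
  presented_mulDl presented_mulDr presented_1neq0.

Fact presented_scaleA a b x :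
  presented_scale a (presented_scale b x) = presented_scale (a * b) x.
Proof. by apply: presented_ext => A f hf; rewrite !liftE scalerA. Qed.
Fact presented_scale1 : left_id 1 presented_scale.
Proof. by move=> x; apply: presented_ext => A f hf; rewrite !liftE scale1r. Qed.
Fact presented_scaleDr : right_distributive presented_scale +%R.
Proof. by move=> c x y; apply: presented_ext => A f hf; rewrite !liftE scalerDr. Qed.
Fact presented_scaleDl x : {morph presented_scale^~ x : a b / a + b}.
Proof. by move=> a b; apply: presented_ext => A f hf; rewrite !liftE scalerDl. Qed.

HB.instance Definition _ := GRing.Zmodule_isLmodule.Build R presented
  presented_scaleA presented_scale1 presented_scaleDr presented_scaleDl.

Fact presented_scaleAl c x y :
  presented_scale c (presented_mul x y) = presented_mul (presented_scale c x) y.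
Proof. by apply: presented_ext => A f hf; rewrite !liftE scalerAl. Qed.

HB.instance Definition _ := GRing.Lmodule_isLalgebra.Build R presented
  presented_scaleAl.

Fact presented_scaleAr c x y :
  presented_scale c (presented_mul x y) = presented_mul x (presented_scale c y).
Proof. by apply: presented_ext => A f hf; rewrite !liftE scalerAr. Qed.

HB.instance Definition _ := GRing.Lalgebra_isAlgebra.Build R presented
  presented_scaleAr.

Section Lift.
Variables (A : algType R) (f : G -> A) (hf : holds P f).

Fact lift_is_zmod_morphism : zmod_morphism (lift hf).
Proof. by move=> x y; rewrite lift_add lift_scale scaleN1r. Qed.
HB.instance Definition _ :=
  GRing.isZmodMorphism.Build presented A (lift hf) lift_is_zmod_morphism.

Fact lift_is_monoid_morphism : monoid_morphism (lift hf).
Proof. by split=> [|x y]; rewrite ?lift_const ?scale1r ?lift_mul. Qed.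
HB.instance Definition _ :=
  GRing.isMonoidMorphism.Build presented A (lift hf) lift_is_monoid_morphism.

Fact lift_is_scalable : scalable (lift hf).
Proof. by move=> c x; rewrite lift_scale. Qed.
HB.instance Definition _ :=
  GRing.isScalable.Build R presented A *:%R (lift hf) lift_is_scalable.

Lemma lift_gen x : lift hf (gen x) = f x.
Proof. by rewrite lift_cls. Qed.

End Lift.

Lemma presented_ind (S : presented -> Prop) :
  (forall x, S (gen x)) -> (forall c, S c%:A) ->
  (forall x y, S x -> S y -> S (x + y)) -> (forall x y, S x -> S y -> S (x * y)) ->
  forall x, S x.
Proof.
move=> Sg Sc Sa Sm x; have -> : x = cls (repr (x : {eq_quot expr_equiv})).
  by rewrite /cls reprK.
elim: (repr _) => [y|c|d Sd e Se|d Sd e Se]; first exact: Sg.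
- suff -> : cls (Const c) = c%:A by exact: Sc.
  by apply: presented_ext => A f hf; rewrite linearZ rmorph1 lift_cls.
- suff -> : cls (Add d e) = cls d + cls e by exact: Sa.
  by apply: presented_ext => A f hf; rewrite raddfD /= !lift_cls.
- suff -> : cls (Mul d e) = cls d * cls e by exact: Sm.
  by apply: presented_ext => A f hf; rewrite rmorphM /= !lift_cls.
Qed.

End PresentedAlgebra.

HB.mixin Record Lmodule_isLie (R : comNzRingType) L of GRing.Lmodule R L := {
  lie : L -> L -> L;
  lie_linearl : forall y, linear (lie^~ y);
  lie_linearr : forall x, linear (lie x);
  liexx : forall x, lie x x = 0;
  lie_jacobi : forall x y z,
    lie x (lie y z) + lie y (lie z x) + lie z (lie x y) = 0 }.

#[short(type="lieAlgType")]
HB.structure Definition LieAlgebra (R : comNzRingType) :=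
  {L of GRing.Lmodule R L & Lmodule_isLie R L}.

#[short(type="finLieAlgType")]
HB.structure Definition FinLieAlgebra (R : comNzRingType) :=
  {L of Vector R L & LieAlgebra R L}.

Section LieTheory.
Variables (R : comNzRingType) (L : lieAlgType R).

HB.instance Definition _ (x : L) :=
  GRing.isLinear.Build R L L *:%R (@lie R L x) (lie_linearr x).

Lemma lieDl (x y z : L) : lie (x + y) z = lie x z + lie y z.
Proof. by have := lie_linearl z 1 x y; rewrite !scale1r. Qed.

Lemma lie0l (z : L) : lie 0 z = 0.
Proof. by apply: (addIr (lie 0 z)); rewrite -lieDl !add0r. Qed.

Lemma lieZl a (x z : L) : lie (a *: x) z = a *: lie x z.
Proof. by have := lie_linearl z a x 0; rewrite !addr0 lie0l addr0. Qed.

Lemma lie_suml I r (P : pred I) (F : I -> L) z :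
  lie (\sum_(i <- r | P i) F i) z = \sum_(i <- r | P i) lie (F i) z.
Proof. by elim/big_rec2: _ => [|i y x _ <-]; rewrite ?lie0l ?lieDl. Qed.

Lemma lieC (x y : L) : lie x y = - lie y x.
Proof.
apply/eqP; rewrite -addr_eq0.
have := liexx (x + y); rewrite lieDl !raddfD /= !liexx add0r addr0.
by move/eqP.
Qed.

End LieTheory.

Section Enveloping.
Variables (R : comNzRingType) (L : lieAlgType R).

Definition env_holds (A : algType R) (f : L -> A) : Prop :=
  linear f /\ forall x y, f (lie x y) = commutator (f x) (f y).

Fact env_holds0 : @env_holds R^o (fun=> 0).
Proof. by split=> [a x y|x y]; rewrite /commutator ?scaler0 ?mulr0 ?subr0 ?addr0. Qed.

Definition env_presentation := Presentation env_holds0.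

Definition envelope := presented env_presentation.
HB.instance Definition _ := GRing.Algebra.on envelope.

Definition env_in (x : L) : envelope := gen env_presentation x.

Lemma env_in_holds : env_holds env_in.
Proof.
split=> [a x y|x y]; apply: presented_ext => A f hf.
  by rewrite linearP /= !lift_gen (proj1 hf).
by rewrite /commutator rmorphB !rmorphM /= !lift_gen (proj2 hf).
Qed.

HB.instance Definition _ := GRing.isLinear.Build R L envelope *:%R env_in
  (proj1 env_in_holds).

Lemma env_in_lie x y : env_in (lie x y) = commutator (env_in x) (env_in y).
Proof. exact: (proj2 env_in_holds). Qed.

End Enveloping.

(** The elements of [L[v] = L (x) R[v]] are encoded as the finitely supported
    sequences of their coefficients. *)

Section Current.
Variables (R : comNzRingType) (L : lieAlgType R).

Definition finsupp : {pred nat -> L} :=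
  fun f => `[< exists N, forall n, (N <= n)%N -> f n = 0 >].

Fact finsupp_submod : submod_closed finsupp.
Proof.
split=> [|a f h /asboolP[M fM] /asboolP[N hN]]; apply/asboolP; first by exists 0%N.
exists (maxn M N) => n; rewrite geq_max => /andP[/fM fn /hN hn].
by rewrite !fctE fn hn scaler0 addr0.
Qed.
HB.instance Definition _ :=
  GRing.isSubmodClosed.Build R (nat -> L) finsupp finsupp_submod.

Record current := Current { coef_of :> nat -> L; _ : coef_of \in finsupp }.

HB.instance Definition _ := [isSub for coef_of].
HB.instance Definition _ := [Choice of current by <:].
HB.instance Definition _ :=
  [SubChoice_isSubLmodule of current by <:].

Definition current_lie_fun (f h : nat -> L) (n : nat) : L :=
  \sum_(i < n.+1) lie (f i) (h (n - i)%N).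

Fact current_lie_subproof (f h : current) : current_lie_fun f h \in finsupp.
Proof.
case: f h => [f /asboolP[M fM]] [h /asboolP[N hN]] /=.
apply/asboolP; exists (M + N)%N => n le_n; apply: big1 => i _.
have [/fM ->|lt_iM] := leqP M i; first by rewrite lie0l.
rewrite hN ?raddf0 // leq_subRL; last by rewrite -ltnS.
by apply: leq_trans le_n; rewrite leq_add2r ltnW.
Qed.

Definition current_lie (f h : current) : current :=
  Current (current_lie_subproof f h).

Let splitE n (F : nat -> nat -> L) :
  \sum_(i < n.+1) F i (n - i)%N =
  \sum_(i < n.+1) \sum_(j < n.+1 | (i + j == n)%N) F i j.
Proof.
apply: eq_bigr => i _; have le_in : (i <= n)%N by rewrite -ltnS.
rewrite (big_pred1 (inord (n - i))) ?inordK ?ltnS ?leq_subr // => j.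
rewrite /= -val_eqE /= inordK ?ltnS ?leq_subr //.
by apply/eqP/eqP => [/(congr1 (subn^~ i))|->]; rewrite ?subnKC ?addKn.
Qed.

Let triple (f1 f2 f3 : nat -> L) n : L :=
  \sum_(i < n.+1) \sum_(j < n.+1) \sum_(k < n.+1 | (i + j + k == n)%N)
    lie (f1 i) (lie (f2 j) (f3 k)).

Let tripleE f1 f2 f3 n :
  current_lie_fun f1 (current_lie_fun f2 f3) n = triple f1 f2 f3 n.
Proof.
apply: eq_bigr => i _; have le_in : (i <= n)%N by rewrite -ltnS.
rewrite [LHS]raddf_sum /= (big_ord_widen n.+1 (fun j => lie (f1 i)
  (lie (f2 j) (f3 (n - i - j)%N)))) ?ltnS ?leq_subr //.
rewrite [LHS]big_mkcond; apply: eq_bigr => j _ /=; rewrite ltnS.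
case: ifPn => [le_j|/negP nle_j].
  rewrite (big_pred1 (inord (n - i - j))) ?inordK ?ltnS -?subnDA ?leq_subr // => k.
  rewrite /= -val_eqE /= inordK ?ltnS ?leq_subr //.
  have le_ij : (i + j <= n)%N by rewrite -leq_subRL.
  by apply/eqP/eqP => [/(congr1 (subn^~ (i + j)%N))|->];
    rewrite -?subnDA ?subnKC ?addKn.
rewrite big_pred0 // => k; apply/negP => /eqP E; apply: nle_j.
by rewrite leq_subRL // (leq_trans (leq_addr k _)) ?E.
Qed.

Fact current_lie_linearl (h : current) : linear (current_lie^~ h).
Proof.
move=> a f1 f2; apply/val_inj/funext => n /=.
transitivity (a *: current_lie_fun f1 h n + current_lie_fun f2 h n) => //.
rewrite /current_lie_fun scaler_sumr -big_split.
by apply: eq_bigr => i _; rewrite /= lieDl lieZl.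
Qed.

Fact current_lie_linearr (f : current) : linear (current_lie f).
Proof.
move=> a f1 f2; apply/val_inj/funext => n /=.
transitivity (a *: current_lie_fun f f1 n + current_lie_fun f f2 n) => //.
rewrite /current_lie_fun scaler_sumr -big_split.
by apply: eq_bigr => i _; rewrite /= linearP.
Qed.

Fact current_liexx (f : current) : current_lie f f = 0.
Proof.
apply/val_inj/funext => n /=; rewrite /current_lie_fun.
rewrite (splitE _ (fun i j => lie (f i) (f j))).
pose F (i j : 'I_n.+1) := if (i + j == n)%N then lie (f i) (f j) else 0.
have -> : \sum_(i < n.+1) \sum_(j < n.+1 | (i + j == n)%N) lie (f i) (f j) =
    \sum_(i < n.+1) \sum_(j < n.+1) F i j.
  by apply: eq_bigr => i _; rewrite big_mkcond.
have FC i j : F i j = - F j i.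
  by rewrite /F addnC; case: ifP => _; rewrite ?oppr0 // lieC.
have F0 i : F i i = 0 by rewrite /F liexx if_same.
rewrite pair_bigA /= (bigID (fun p : 'I_n.+1 * 'I_n.+1 => p.1 < p.2)%N) /=.
rewrite [X in _ + X](bigID (fun p : 'I_n.+1 * 'I_n.+1 => p.1 == p.2)) /=.
rewrite [X in _ + (X + _)]big1 ?add0r => [|[i j] /= /andP[_ /eqP->]//].
rewrite [X in _ + X](reindex_inj (h := fun p => (p.2, p.1))) /=; last first.
  by move=> [i j] [k l] [-> ->].
rewrite [X in _ + X](eq_bigl (fun p : 'I_n.+1 * 'I_n.+1 => p.1 < p.2)%N); last first.
  by case=> i j /=; rewrite -leqNgt ltn_neqAle -val_eqE eq_sym andbC.
by rewrite -big_split big1 // => -[i j] _ /=; rewrite FC addNr.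
Qed.

Fact current_lie_jacobi (f g h : current) :
  current_lie f (current_lie g h) + current_lie g (current_lie h f) +
  current_lie h (current_lie f g) = 0.
Proof.
apply/val_inj/funext => n /=; rewrite !fctE /= !tripleE.
have -> : triple g h f n = \sum_(i < n.+1) \sum_(j < n.+1)
    \sum_(k < n.+1 | (i + j + k == n)%N) lie (g j) (lie (h k) (f i)).
  rewrite /triple; under eq_bigr do under eq_bigr do rewrite big_mkcond.
  under eq_bigr do rewrite exchange_big; rewrite exchange_big.
  apply: eq_bigr => i _; apply: eq_bigr => j _; rewrite [RHS]big_mkcond.
  by apply: eq_bigr => k _; rewrite addnC addnA.
have -> : triple h f g n = \sum_(i < n.+1) \sum_(j < n.+1)
    \sum_(k < n.+1 | (i + j + k == n)%N) lie (h k) (lie (f i) (g j)).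
  rewrite /triple; under eq_bigr do under eq_bigr do rewrite big_mkcond.
  rewrite exchange_big; apply: eq_bigr => i _.
  rewrite exchange_big; apply: eq_bigr => j _; rewrite [RHS]big_mkcond.
  by apply: eq_bigr => k _; rewrite -addnA addnC.
rewrite -!big_split big1 // => i _; rewrite -!big_split big1 // => j _.
by rewrite -!big_split big1 // => k _; rewrite /= lie_jacobi.
Qed.

HB.instance Definition _ := Lmodule_isLie.Build R current
  current_lie_linearl current_lie_linearr current_liexx current_lie_jacobi.

Fact monomial_subproof (x : L) m : (fun n => if n == m then x else 0) \in finsupp.
Proof.
by apply/asboolP; exists m.+1 => n lt_mn; rewrite gtn_eqF.
Qed.

(** [x (x) v^m] *)
Definition monomial (m : nat) (x : L) : current := Current (monomial_subproof x m).

End Current.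

Section CurrentTheory.
Variables (R : comNzRingType) (L : lieAlgType R).

Lemma monomial_is_linear m : linear (@monomial R L m).
Proof.
move=> a x y; apply/val_inj/funext => n /=.
transitivity (a *: (if n == m then x else 0) + (if n == m then y else 0)) => //.
by case: ifP; rewrite ?scaler0 ?addr0.
Qed.
HB.instance Definition _ m := GRing.isLinear.Build R L (current L) *:%R
  (@monomial R L m) (monomial_is_linear m).

Lemma lie_monomial (x y : L) m n :
  lie (monomial m x) (monomial n y) = monomial (m + n) (lie x y).
Proof.
apply/val_inj/funext => k /=; rewrite /current_lie_fun /=.
have [le_mk|lt_km] := leqP m k; last first.
  rewrite ltn_eqF ?(leq_trans lt_km) ?leq_addr // big1 // => i _.
  by rewrite ltn_eqF ?lie0l // (leq_ltn_trans _ lt_km) // -ltnS.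
rewrite (bigD1 (Ordinal (le_mk : (m < k.+1)%N))) //= eqxx big1 ?addr0.
  rewrite -(eqn_add2l m) subnKC //; case: ifP => // _.
  exact: raddf0.
by move=> i; rewrite -val_eqE /= => /negPf ->; rewrite lie0l.
Qed.

Lemma current_sum (c : current L) N :
  (forall n, (N <= n)%N -> c n = 0) -> c = \sum_(i < N) monomial i (c i).
Proof.
move=> cN; apply/val_inj/funext => n /=.
have -> : coef_of (\sum_(i < N) monomial i (c i)) n =
    \sum_(i < N) (if n == i then c i else 0).
  by elim/big_rec2: _ => [//|i y z _ <-].
have [lt_nN|le_Nn] := ltnP n N.
  rewrite (bigD1 (Ordinal lt_nN)) //= eqxx big1 ?addr0 // => i.
  by rewrite -val_eqE /= eq_sym => /negPf ->.
rewrite cN // big1 // => i _; case: eqP => // E.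
by rewrite cN // -E.
Qed.

End CurrentTheory.

Section ScalarExtension.
Variables (R : comNzRingType) (L : lieAlgType R) (A : algType {poly R}).

(** [A] as an algebra over the constants of [{poly R}]. *)
Definition restricted : Type := A.
HB.instance Definition _ := GRing.NzRing.on restricted.

Definition restricted_scale (c : R) (x : restricted) : restricted :=
  (c%:P *: (x : A) : A).

Fact restricted_scaleA a b x :
  restricted_scale a (restricted_scale b x) = restricted_scale (a * b) x.
Proof. by rewrite /restricted_scale scalerA -polyCM. Qed.
Fact restricted_scale1 : left_id 1 restricted_scale.
Proof. by move=> x; rewrite /restricted_scale scale1r. Qed.
Fact restricted_scaleDr : right_distributive restricted_scale +%R.
Proof. by move=> c x y; rewrite /restricted_scale scalerDr. Qed.
Fact restricted_scaleDl x : {morph restricted_scale^~ x : a b / a + b}.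
Proof. by move=> a b; rewrite /restricted_scale polyCD scalerDl. Qed.
HB.instance Definition _ := GRing.Zmodule_isLmodule.Build R restricted
  restricted_scaleA restricted_scale1 restricted_scaleDr restricted_scaleDl.

Fact restricted_scaleAl (c : R) (x y : restricted) : c *: (x * y) = (c *: x) * y.
Proof. exact: (@scalerAl {poly R} A). Qed.
HB.instance Definition _ := GRing.Lmodule_isLalgebra.Build R restricted
  restricted_scaleAl.
Fact restricted_scaleAr (c : R) (x y : restricted) : c *: (x * y) = x * (c *: y).
Proof. exact: (@scalerAr {poly R} A). Qed.
HB.instance Definition _ := GRing.Lalgebra_isAlgebra.Build R restricted
  restricted_scaleAr.

Lemma env_lift (f : L -> A) :
  linear_for (polyC \; *:%R) f ->
  (forall x y, f (lie x y) = commutator (f x) (f y)) ->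
  exists phi : {lrmorphism envelope L -> A | polyC \; *:%R},
    forall x, phi (env_in x) = f x.
Proof.
move=> fL fB; have hf : holds (env_presentation L) (f : L -> restricted) by split.
pose phi : envelope L -> A := lift hf.
have phiB : zmod_morphism phi by exact: (raddfB (lift hf)).
have phiM : monoid_morphism phi.
  by split; [exact: (rmorph1 (lift hf)) | exact: (rmorphM (lift hf))].
have phiZ : scalable_for (polyC \; *:%R) phi by exact: (linearZ_LR (lift hf)).
pose m1 := GRing.isZmodMorphism.Build _ _ phi phiB.
pose m2 := GRing.isMonoidMorphism.Build _ _ phi phiM.
pose m3 := GRing.isScalable.Build _ _ _ _ phi phiZ.
pose F : {lrmorphism envelope L -> A | polyC \; *:%R} := HB.pack phi m1 m2 m3.
by exists F => x; exact: (lift_gen hf).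
Qed.

(** [x |-> iota x] and [x (x) v |-> kappa x] extend to an algebra map
    [U(L[v]) -> A]. *)
Definition extends_to_current (iota kappa : L -> A) : Prop :=
  exists phi : {lrmorphism envelope (current L) -> A | polyC \; *:%R},
    forall x, phi (env_in (monomial 0 x)) = iota x /\
              phi (env_in (monomial 1 x)) = kappa x.

End ScalarExtension.

(** When [L = [L, L]], the condition [extends_to_current] passes to the
    algebra it presents. *)
Lemma presented_extends (R : comNzRingType) (L : lieAlgType R) (G : Type)
    (P : presentation {poly R} G) (i k : L -> G) :
  (forall z : L, exists s : seq (L * L), z = \sum_(p <- s) lie p.1 p.2) ->
  (forall (A : algType {poly R}) (f : G -> A), holds P f ->
     extends_to_current (f \o i) (f \o k)) ->
  extends_to_current (gen P \o i) (gen P \o k).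
Proof.
move=> /choice[d dE] ext.
pose fix kk (n : nat) (z : L) {struct n} : presented P :=
  match n with
  | 0 => gen P (i z)
  | n'.+1 => if n' == 0 then gen P (k z)
             else \sum_(p <- d z) commutator (kk n' p.1) (gen P (k p.2))
  end.
have kkE (A : algType {poly R}) (f : G -> A) (hf : holds P f)
    (phi : {lrmorphism envelope (current L) -> A | polyC \; *:%R}) :
    (forall x, phi (env_in (monomial 0 x)) = f (i x) /\
              phi (env_in (monomial 1 x)) = f (k x)) ->
    forall n z, lift hf (kk n z) = phi (env_in (monomial n z)).
  move=> phiE; elim=> [|[|n] IHn] z.
  - by rewrite (phiE z).1 lift_gen.
  - by rewrite (phiE z).2 lift_gen.
  have -> : kk n.+2 z = \sum_(p <- d z) commutator (kk n.+1 p.1) (gen P (k p.2)).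
    by [].
  rewrite {2}(dE z) !raddf_sum /=.
  apply: eq_bigr => p _.
  rewrite -[n.+2]addn1 -lie_monomial env_in_lie /commutator !rmorphB !rmorphM /=.
  by rewrite IHn !lift_gen (phiE _).2.
have bound (c : current L) : exists N, forall n, (N <= n)%N -> c n = 0.
  by case: c => c0 c0fin; exact/asboolP.
have [N NE] := choice bound.
pose F (c : current L) := \sum_(j < N c) kk j (c j).
have FE (A : algType {poly R}) (f : G -> A) (hf : holds P f)
    (phi : {lrmorphism envelope (current L) -> A | polyC \; *:%R}) :
    (forall x, phi (env_in (monomial 0 x)) = f (i x) /\
              phi (env_in (monomial 1 x)) = f (k x)) ->
    forall c, lift hf (F c) = phi (env_in c).
  move=> phiE c; rewrite {2}(current_sum (NE c)) !raddf_sum; apply: eq_bigr => j _.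
  exact: kkE.
have [||phi phiE] := @env_lift R (current L) (presented P) F.
- move=> a x y; apply: presented_ext => A f hf; have [phi phiE] := ext A f hf.
  rewrite raddfD /= linearZ /= !(FE _ _ _ _ phiE) linearP raddfD /=; congr (_ + _).
  exact: linearZ_LR.
- move=> x y; apply: presented_ext => A f hf; have [phi phiE] := ext A f hf.
  by rewrite /commutator rmorphB !rmorphM /= !(FE _ _ _ _ phiE) env_in_lie rmorphB !rmorphM.
exists phi => x; rewrite !phiE /=; split; apply: presented_ext => A f hf;
  by have [psi psiE] := ext A f hf; rewrite lift_gen (FE _ _ _ _ psiE) ?(psiE x).1 ?(psiE x).2.
Qed.

Section Roots.
Variables (K : fieldType) (g : finLieAlgType K).

Definition lie_ideal (I : {vspace g}) : Prop :=
  forall x y, y \in I -> lie x y \in I.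

Definition simple_lie : Prop :=
  (exists x y : g, lie x y <> 0) /\
  (forall I : {vspace g}, lie_ideal I -> I = 0%VS \/ I = fullv).

Lemma simple_perfect : simple_lie ->
  forall z : g, exists s : seq (g * g), z = \sum_(p <- s) lie p.1 p.2.
Proof.
case=> [[x0 [y0 nz]] simple].
set b := vbasis (fullv : {vspace g}).
pose bb := [seq (p, q) | p <- (b : seq g), q <- (b : seq g)].
pose br (p : g * g) := lie p.1 p.2.
pose I := (<<[seq br p | p <- bb]>>)%VS.
have inI x y : lie x y \in I.
  rewrite (coord_vbasis (memvf x)) lie_suml memv_suml // => i _.
  rewrite lieZl memvZ // (coord_vbasis (memvf y)) raddf_sum memv_suml // => j _.
  rewrite /= linearZ memvZ // memv_span //.
  apply/mapP; exists (b`_i, b`_j) => //; apply/allpairsP.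
  by exists (b`_i, b`_j); rewrite !mem_nth ?size_tuple.
have [I0|IT] := simple I (fun x y _ => inI x y).
  by case: nz; apply/eqP; rewrite -memv0 -I0.
move=> z; pose t := in_tuple [seq br p | p <- bb].
have /coord_span zE : z \in <<t>>%VS by rewrite -/I IT memvf.
exists [seq (coord t i z *: (nth (0, 0) bb i).1, (nth (0, 0) bb i).2)
         | i : 'I_(size [seq br p | p <- bb])].
rewrite {1}zE big_map big_enum /=; apply: eq_bigr => i _.
by rewrite lieZl (nth_map (0, 0)) // -(size_map br) ltn_ord.
Qed.

(** Cartan subalgebras of a semisimple Lie algebra: maximal abelian
    subalgebras acting diagonalizably in the adjoint representation. *)
Record cartan_subalgebra (H : {vspace g}) : Prop := {
  cartan_abelian : forall h k, h \in H -> k \in H -> lie h k = 0;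
  cartan_maximal : forall x, (forall h, h \in H -> lie h x = 0) -> x \in H;
  cartan_diagonalizable : forall h, h \in H -> exists b : seq g,
    basis_of fullv b /\ forall x, x \in b -> exists c : K, lie h x = c *: x }.

Record invariant_form (B : g -> g -> K) : Prop := {
  form_linear : forall y, scalar (B^~ y);
  form_sym : forall x y, B x y = B y x;
  form_invariant : forall x y z, B (lie x y) z = B x (lie y z);
  form_nondegenerate : forall x, (forall y, B x y = 0) -> x = 0 }.

Variables (H : {vspace g}) (B : g -> g -> K).

Definition root_vector (a : 'Hom(subvs_of H, K^o)) (x : g) : Prop :=
  forall h : subvs_of H, lie (vsval h) x = (a h : K) *: x.

Definition roots : set 'Hom(subvs_of H, K^o) :=
  [set a | a <> 0 /\ exists x, x <> 0 /\ root_vector a x]%classic.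

Lemma root_vectors_free (x : 'Hom(subvs_of H, K^o) -> g) s :
  uniq s -> (forall a, a \in s -> x a <> 0 /\ root_vector a (x a)) ->
  forall c : 'Hom(subvs_of H, K^o) -> K,
  \sum_(a <- s) c a *: x a = 0 -> forall a, a \in s -> c a = 0.
Proof.
elim: s => [|b s IHs] //= /andP[b_s s_uniq] xs c.
rewrite big_cons => sum0.
have c0 a : a \in s -> c a = 0.
  move=> as_; apply/eqP; apply: contraT => ca.
  suff E : a = b by rewrite -E as_ in b_s.
  apply/lfunP => h; apply/eqP; rewrite -subr_eq0.
  have xs' d : d \in s -> x d <> 0 /\ root_vector d (x d).
    by move=> ds; apply: xs; rewrite inE ds orbT.
  have/eqP : c a * (a h - b h) = 0.
    apply: (IHs s_uniq xs' (fun d => c d * (d h - b h))) => //.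
    have := congr1 (fun z => lie (vsval h) z - (b h : K) *: z) sum0.
    rewrite raddf0 scaler0 subr0 => sum0'; rewrite -[RHS]sum0'.
    rewrite raddfD /= scalerDr opprD addrACA.
    rewrite linearZ /= (xs b (mem_head _ _)).2 !scalerA mulrC subrr add0r.
    rewrite raddf_sum scaler_sumr -sumrB /= [LHS]big_seq [RHS]big_seq.
    apply: eq_bigr => d ds; rewrite linearZ /= (xs' d ds).2 !scalerA -scalerBl.
    by rewrite mulrBr [b h * _]mulrC.
  by rewrite mulf_eq0 (negPf ca).
move=> a; rewrite inE => /orP[/eqP ->|/c0 //].
move: sum0; rewrite big_seq big1 ?addr0 => [/eqP|d /c0 ->]; last exact: scale0r.
by rewrite scaler_eq0 => /orP[/eqP //|/eqP /(xs b (mem_head _ _)).1].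
Qed.

(** In particular [fset_set (roots H)] enumerates the roots. *)
Lemma finite_roots : finite_set roots.
Proof.
apply: contrapT => /(infinite_set_fset (\dim (fullv : {vspace g})).+1)[s sR].
rewrite leqNgt ltnS; case/negP.
have /choice[x xE] a : exists x : g, roots a -> x <> 0 /\ root_vector a x.
  have [[_ [x xE]]|nR] := pselect (roots a); last by exists 0.
  by exists x.
have xs a : a \in (s : seq _) -> x a <> 0 /\ root_vector a (x a).
  by move=> /sR /xE.
have xfree := root_vectors_free (fset_uniq s) xs.
have/dimvS := subvf (<<[seq x a | a <- s]>>%VS).
suff /eqP -> : free [seq x a | a <- s] by rewrite size_map.
apply/(@freeP _ _ _ (in_tuple [seq x a | a <- s])) => k k0 i.
pose c a := if insub (index a s) is Some j then k j else 0.
have ci (j : 'I_(size [seq x a | a <- s])) : c (nth 0 s j) = k j.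
  rewrite /c index_uniq ?fset_uniq ?valK //.
  by rewrite -(size_map x) ltn_ord.
rewrite -ci; apply: xfree; last by rewrite mem_nth // -(size_map x) ltn_ord.
rewrite -[RHS]k0 (big_nth 0) big_mkord -(size_map x); apply: eq_bigr => j _.
by rewrite ci (nth_map 0) // -(size_map x) ltn_ord.
Qed.

(** The element of [H] representing [a] through the form. *)
Definition dual_vector (a : 'Hom(subvs_of H, K^o)) : g :=
  xget 0 [set t | t \in H /\ forall h : subvs_of H, B t (vsval h) = a h]%classic.

Definition dual_form (a b : 'Hom(subvs_of H, K^o)) : K := B (dual_vector a) (dual_vector b).

Definition normalized_root_vectors (X : 'Hom(subvs_of H, K^o) -> g) : Prop :=
  forall a, roots a -> root_vector a (X a) /\ B (X a) (X (- a)) = 1.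

End Roots.

Arguments simple_lie {K} g.
Arguments roots {K g} H _.

(** Long roots have squared length 2.  The squared lengths are compared in the
    partial order of the complex numbers, where comparability of [(b, b)] with 2
    forces [(b, b)] to be real. *)
Definition normalized_form (R : realType) (g : finLieAlgType R[i])
    (H : {vspace g}) (B : g -> g -> R[i]) : Prop :=
  (exists2 a, roots H a & dual_form B a a = 2) /\
  (forall b, roots H b -> dual_form B b b <= 2).

Inductive dgen (g : Type) :=
  | GenX of g
  | GenK of g
  | GenQ of g
  | GenP of g.

Section DAlgebra.
Variables (K : fieldType) (g : finLieAlgType K) (H : {vspace g}).
Variables (B : g -> g -> K) (X : 'Hom(subvs_of H, K^o) -> g).

Local Notation lambda := ('X : {poly K}).

Definition d_holds (A : algType {poly K}) (f : dgen g -> A) : Prop :=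
  let x z := f (GenX z) in let k z := f (GenK z) in
  let q z := f (GenQ z) in let p z := f (GenP z) in
  [/\ extends_to_current x k,
      extends_to_current x q,
      linear_for (polyC \; *:%R) p,
      forall y z, commutator (x y) (p z) = p (lie y z) &
      forall b1 b2, roots H b1 -> roots H b2 -> b1 <> - b2 ->
        commutator (k (X b1)) (q (X b2)) =
          p (lie (X b1) (X b2))
          - ((dual_form B b1 b2 / 4) *: lambda)
              *: anticommutator (x (X b1)) (x (X b2))
          + (4^-1 *: lambda)
              *: \sum_(a <- fset_set (roots H))
                   anticommutator (x (lie (X b1) (X a))) (x (lie (X (- a)) (X b2)))].

Fact d_holds0 : @d_holds {poly K}^o (fun=> 0).
Proof.
have e0 : @extends_to_current K g {poly K}^o (fun=> 0) (fun=> 0).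
  have [||phi phiE] := @env_lift K (current g) {poly K}^o (fun=> 0).
  - by move=> a x y; rewrite /= scaler0 addr0.
  - by move=> x y; rewrite /commutator mulr0 subrr.
  by exists phi => x; rewrite !phiE.
split=> //.
- by move=> a x y; rewrite /= scaler0 addr0.
- by move=> y z; rewrite /commutator mulr0 subrr.
move=> b1 b2 _ _ _; rewrite /commutator /anticommutator big1 => [|a _]; last by rewrite mulr0 addr0.
by rewrite !mulr0 addr0 !scaler0 subrr addr0.
Qed.

Definition d_presentation := Presentation d_holds0.

Definition Dlambda := presented d_presentation.
HB.instance Definition _ := GRing.Algebra.on Dlambda.

Definition dX (z : g) : Dlambda := gen d_presentation (GenX z).
Definition dK (z : g) : Dlambda := gen d_presentation (GenK z).
Definition dQ (z : g) : Dlambda := gen d_presentation (GenQ z).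
Definition dP (z : g) : Dlambda := gen d_presentation (GenP z).

Lemma d_holds_gen : simple_lie g -> d_holds (gen d_presentation).
Proof.
move=> /simple_perfect gP.
split.
- by apply: (presented_extends (i := @GenX g) (k := @GenK g)) gP _ => A f [].
- by apply: (presented_extends (i := @GenX g) (k := @GenQ g)) gP _ => A f [].
- move=> a y z; apply: presented_ext => A f hf; have [_ _ pL _ _] := hf.
  by rewrite raddfD /= linearZ /= !lift_gen pL.
- move=> y z; apply: presented_ext => A f hf; have [_ _ _ pE _] := hf.
  by rewrite /commutator rmorphB !rmorphM /= !lift_gen; apply: pE.
move=> b1 b2 r1 r2 b12; apply: presented_ext => A f hf; have [_ _ _ _ pE] := hf.
rewrite /commutator /anticommutator [LHS]rmorphB !rmorphM /= !lift_gen.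
rewrite [RHS]raddfD /= raddfB /= !linearZ /= raddf_sum /= lift_gen.
rewrite rmorphD !rmorphM /= !lift_gen.
under eq_bigr do rewrite rmorphD !rmorphM /= !lift_gen.
by rewrite scalerN; exact: (pE b1 b2 r1 r2 b12).
Qed.

End DAlgebra.

Definition SL2 (K : fieldType) : {pred 'M[K]_2} := fun M => \det M == 1.
Arguments SL2 K _ : clear implicits.

Definition right_SL2_action (K : fieldType) (S : comNzRingType) (D : algType S)
    (act : 'M[K]_2 -> {lrmorphism D -> D}) : Prop :=
  [/\ forall M, M \in SL2 K -> bijective (act M),
      act 1%:M =1 id &
      forall M N, M \in SL2 K -> N \in SL2 K -> act (M *m N) =1 act N \o act M].

Definition has_order (T : Type) (n : nat) (s : T -> T) : Prop :=
  [/\ (0 < n)%N, iter n s =1 id &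
      forall k, (0 < k < n)%N -> ~ (iter k s =1 id)].

(* Main.v *)
(** Put [K' = a K + b Q]. That [K'] satisfies the relations of [U(g[v])] rests on
    two facts about a simple Lie algebra of rank at least 2 acting on a module.

    First, the relations give [[K y, Q w] - [K w, Q y] = 2 P [y, w]] on pairs of
    root vectors whose roots are not opposite, since the terms in [lambda] are
    symmetric; an equivariant alternating form that vanishes on such pairs
    vanishes identically. Hence [[K' y, K' w]] depends only on [[y, w]].

    Second, an equivariant form [phi] with [phi h [h', z] = phi h' [h, z]] for
    [h], [h'] in the Cartan subalgebra has the shape
    [phi x y = T [x, y] + theta x y], with [theta] symmetric and invariant. The
    map [T] is obtained by composing [phi] with the equivariant section of the
    bracket given by the Casimir tensor, which avoids complete reducibility.
    Applied to [phi x y = [K'_1 x, K'_N y]], this constructs [K'_(N+1) = T] by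
    induction on [N]: the Jacobi identity shows that the defect of
    [[K'_i x, K'_(N+1-i) y]] is [i theta], and antisymmetry at [i = N] gives
    [(N + 1) theta = 0].

    The relation between [K'] and [Q'] then follows from [det = 1]. The
    automorphism has order exactly 4 because [K] is nonzero in the module over
    [Dlambda] in which [lambda], [P] and [Q] are 0 and [X], [K] both act by the
    adjoint representation. *)

Require Import Defs.
From HB Require Import structures.
From mathcomp Require Import all_boot all_order all_algebra.
From mathcomp.real_closed Require Import complex.
From mathcomp Require Import finmap boolp classical_sets functions cardinality reals.
From mathcomp Require Import ring zify.
Import Defs.

Set Implicit Arguments.
Unset Strict Implicit.
Unset Printing Implicit Defensive.

Import Order.TTheory GRing.Theory Num.Theory.
Local Open Scope ring_scope.

(** * Lie algebra preliminaries *)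

Section LieLemmas.
Variables (R : comNzRingType) (L : lieAlgType R).
Implicit Types x y z : L.

Lemma lieDr x y z : lie x (y + z) = lie x y + lie x z.
Proof. exact: raddfD. Qed.

Lemma lieZr a x y : lie x (a *: y) = a *: lie x y.
Proof. exact: linearZ. Qed.

Lemma lie0r x : lie x 0 = 0.
Proof. exact: raddf0. Qed.

Lemma lieNr x y : lie x (- y) = - lie x y.
Proof. exact: raddfN. Qed.

Lemma lieNl x y : lie (- x) y = - lie x y.
Proof. by rewrite lieC lieNr -lieC. Qed.

Lemma lieBr x y z : lie x (y - z) = lie x y - lie x z.
Proof. exact: raddfB. Qed.

Lemma lie_sumr I r (P : pred I) (F : I -> L) z :
  lie z (\sum_(i <- r | P i) F i) = \sum_(i <- r | P i) lie z (F i).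
Proof. exact: raddf_sum. Qed.

Lemma lie_derivation x y z : lie x (lie y z) = lie (lie x y) z + lie y (lie x z).
Proof.
have := lie_jacobi x y z; rewrite (lieC z x) lieNr (lieC z (lie x y)).
by move/eqP; rewrite subr_eq0 subr_eq addrC => /eqP.
Qed.

End LieLemmas.

(** * Highest weight vectors for an sl2 triple *)

Section Sl2.
Variables (K : numFieldType) (L : lieAlgType K) (e f v : L) (m s : K).
Hypotheses (hv : lie (lie e f) v = m *: v) (ev : lie e v = 0).
Hypothesis hf : lie (lie e f) f = - s *: f.

Let w n := iter n (lie f) v.

Lemma sl2_weight n : lie (lie e f) (w n) = (m - n%:R * s) *: w n.
Proof.
elim: n => [|n IHn]; first by rewrite mul0r subr0.
rewrite /w iterS -/(w n) lie_derivation hf IHn lieZl lieZr -scalerDl.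
by congr (_ *: _); rewrite -natr1; ring.
Qed.

Lemma sl2_raise n : lie e (w n.+1) = (n.+1%:R * (m - n%:R / 2 * s)) *: w n.
Proof.
elim: n => [|n IHn]; rewrite /w iterS -/(w _) lie_derivation.
  by rewrite ev lie0r addr0 hv mul1r mul0r mul0r subr0.
rewrite IHn sl2_weight lieZr -[lie f (w n)]/(w n.+1) -scalerDl; congr (_ *: _).
by rewrite -!natr1; field.
Qed.

(** If [w j.+1] is the first zero, [sl2_raise] forces the factor [m - j / 2 * s] to vanish. The
    scalar [s] replaces the usual 2 because [lie e f] will be the dual vector of a root, not its
    coroot. *)
Lemma sl2_highest n : v != 0 -> w n = 0 -> exists j : nat, m = j%:R / 2 * s.
Proof.
move=> v0 wn0; have ex : exists n, w n == 0 by exists n; apply/eqP.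
case: (ex_minnP ex) => -[|j] /eqP wj min; first by rewrite /w /= in wj; rewrite wj eqxx in v0.
exists j; have := sl2_raise j; rewrite wj lie0r => /esym/eqP.
rewrite scaler_eq0 mulf_eq0 pnatr_eq0 /= subr_eq0 => /orP[/eqP//|/min].
by rewrite ltnn.
Qed.

End Sl2.

(** * Eigencomponents inside an invariant subspace *)

Section Diagonalization.
Variables (K : fieldType) (V : lmodType K) (f : V -> V) (W : V -> Prop).
Hypotheses (fB : forall x y, f (x + y) = f x + f y) (fZ : forall a x, f (a *: x) = a *: f x).
Hypotheses (WB : forall x y, W x -> W y -> W (x - y)) (WZ : forall a x, W x -> W (a *: x)).
Hypothesis Wf : forall x, W x -> W (f x).

(* Applying [f - mu] removes the [mu]-component and rescales the others. *)
Lemma stable_eigencomponents (v : K -> V) (s : seq K) :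
  uniq s -> (forall mu, f (v mu) = mu *: v mu) ->
  W (\sum_(mu <- s) v mu) -> forall mu, mu \in s -> W (v mu).
Proof.
have f0 : f 0 = 0 by apply: (addrI (f 0)); rewrite -fB !addr0.
elim: s v => [//|nu s IHs] v /= /andP[nu_s s_uniq] fv; rewrite big_cons => Wsum.
have Ws mu : mu \in s -> W (v mu).
  move=> mus; have mn : mu - nu != 0.
    by rewrite subr_eq0; apply: contra nu_s => /eqP <-.
  rewrite -[v mu]scale1r -(mulVf mn) -scalerA; apply: WZ.
  apply: (IHs (fun mu => (mu - nu) *: v mu)) => // [k|].
    by rewrite fZ fv !scalerA mulrC.
  have -> : \sum_(mu <- s) (mu - nu) *: v mu =
      f (v nu + \sum_(mu <- s) v mu) - nu *: (v nu + \sum_(mu <- s) v mu).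
    rewrite fB fv scalerDr opprD addrACA subrr add0r (big_morph f fB f0) scaler_sumr -sumrB.
    by apply: eq_bigr => k _; rewrite fv scalerBl.
  by apply: WB; [apply: Wf|apply: WZ].
move=> mu; rewrite inE => /orP[/eqP ->|/Ws //].
have W0 : W 0 by rewrite -(subrr (v nu + \sum_(mu <- s) v mu)); apply: WB.
rewrite -[v nu](addrK (\sum_(mu <- s) v mu)); apply: WB => //.
rewrite big_seq; elim/big_rec: _ => // k x /Ws Wk Wx.
by rewrite -[x]opprK; apply: WB => //; rewrite -sub0r; apply: WB.
Qed.

End Diagonalization.

(** * Weight decomposition *)

Section Weights.
Variables (K : numFieldType) (g : finLieAlgType K) (H : {vspace g}).
Local Notation weight := 'Hom(subvs_of H, K^o).
Implicit Types (x y z : g).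

(** Simultaneous diagonalization, by induction on [l]: a joint eigenvector of the tail is split
    along the eigenspaces of the head [h]. Its components stay joint eigenvectors of the tail
    because the operators commute. *)
Lemma joint_eigenvector_ind (l : seq g) (P : g -> Prop) :
  (forall h k, h \in l -> k \in l -> lie h k = 0) ->
  (forall h, h \in l -> exists b : seq g,
    basis_of fullv b /\ forall x, x \in b -> exists c : K, lie h x = c *: x) ->
  (forall x, (forall h, h \in l -> exists c : K, lie h x = c *: x) -> P x) ->
  (forall x y, P x -> P y -> P (x + y)) -> forall z, P z.
Proof.
move=> comm diag PE PD; have P0 : P 0.
  by apply: PE => h _; exists 0; rewrite lie0r scale0r.
elim: l comm diag PE => [|h l IHl] comm diag PE; first by move=> z; apply: PE.
apply: IHl => [k k' kl k'l|k kl|x xE].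
- by apply: comm; rewrite inE ?kl ?k'l orbT.
- by apply: diag; rewrite inE kl orbT.
have {xE} /choice[e eE] k : exists c : K, k \in l -> lie k x = c *: x.
  by have [/xE[c ?]|] := boolP (k \in l); [exists c|exists 0].
have [b [bB bE]] := diag h (mem_head _ _).
have {bE} /choice[ev evE] y : exists c : K, y \in b -> lie h y = c *: y.
  by have [/bE[c ?]|] := boolP (y \in b); [exists c|exists 0].
pose n := size b; pose F (i : 'I_n) := coord (in_tuple b) i x *: b`_i.
(* Repeated eigenvalues are merged, so that [v mu] is the whole [mu]-component of [x]. *)
pose s := undup [seq ev y | y <- b].
pose v mu := \sum_(i < n | ev b`_i == mu) F i.
have vE mu : lie h (v mu) = mu *: v mu.
  rewrite lie_sumr scaler_sumr; apply: eq_bigr => i /eqP <-.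
  by rewrite lieZr evE ?mem_nth // !scalerA mulrC.
have sumv : \sum_(mu <- s) v mu = x.
  have xb : x \in <<in_tuple b>>%VS by case/andP: bB => /eqP -> _; rewrite memvf.
  rewrite [RHS](coord_span xb) (exchange_big_dep xpredT) //=; apply: eq_bigr => i _.
  rewrite -big_filter (perm_big [:: ev b`_i]) ?big_seq1 //.
  apply: uniq_perm; rewrite ?filter_uniq ?undup_uniq // => mu.
  rewrite mem_filter mem_undup inE eq_sym; case: eqP => //= ->.
  by rewrite map_f ?mem_nth.
suff Pv mu : mu \in s -> P (v mu).
  by rewrite -sumv big_seq; elim/big_rec: _ => // mu y /Pv; apply: PD.
move=> mus; apply: PE => k; rewrite inE => /orP[/eqP ->|kl]; first by exists mu.
exists (e k); move: k kl.
pose W y := forall k, k \in l -> lie k y = e k *: y.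
apply: (@stable_eigencomponents K g (lie h) W _ _ _ _ _ v s) => //.
- exact: lieDr.
- by move=> *; rewrite lieZr.
- by move=> y z Wy Wz k kl; rewrite lieBr Wy ?Wz ?scalerBr.
- by move=> c y Wy k kl; rewrite lieZr Wy // !scalerA mulrC.
- move=> y Wy k kl; rewrite lie_derivation (comm k h) ?inE ?kl ?eqxx ?orbT //.
  by rewrite lie0l add0r Wy // lieZr.
- exact: undup_uniq.
by rewrite sumv => k kl; rewrite eE.
Qed.

(** A joint eigenvector for a basis of [H] is one for all of [H]; it remains to see that its
    eigenvalues form a linear functional. *)
Lemma weight_vector_ind : cartan_subalgebra H -> forall P : g -> Prop,
  (forall (a : weight) x, root_vector a x -> P x) ->
  (forall x y, P x -> P y -> P (x + y)) -> forall z, P z.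
Proof.
case=> comm _ diag P PE; apply: (joint_eigenvector_ind (l := vbasis H)).
- by move=> h k /vbasis_mem hH /vbasis_mem kH; apply: comm.
- by move=> h /vbasis_mem /diag.
move=> x xE; have [x0|/eqP x0] := pselect (x = 0).
  by apply: (PE 0) => h; rewrite x0 lie0r scaler0.
have hE (h : subvs_of H) : exists c : K, lie (vsval h) x = c *: x.
  rewrite (coord_vbasis (subvsP h)).
  suff /choice[e eE] i : exists c : K, lie (vbasis H)`_i x = c *: x.
    exists (\sum_i coord (vbasis H) i (vsval h) * e i).
    by rewrite lie_suml scaler_suml; apply: eq_bigr => i _; rewrite lieZl eE scalerA.
  have [lt_i|le_i] := ltnP i (size (vbasis H)); first by apply: xE; rewrite mem_nth.
  by exists 0; rewrite nth_default // lie0l scale0r.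
have [i xi] : exists i, coord (vbasis fullv) i x != 0.
  apply: contrapT => nx; case/eqP: x0.
  rewrite (coord_vbasis (memvf x)) big1 // => i _.
  have [->|nz] := eqVneq (coord (vbasis fullv) i x) 0; rewrite ?scale0r //; case: nx; by exists i.
(* The eigenvalue is read off from one nonzero coordinate of [x], which makes it linear in [h]. *)
pose f (h : subvs_of H) : K^o :=
  coord (vbasis fullv) i (lie (vsval h) x) / coord (vbasis fullv) i x.
have fL : linear f.
  move=> c h k; rewrite /f !linearP /= lieDl lieZl linearD linearZ /=.
  by rewrite mulrDl -mulrA.
pose m := GRing.isLinear.Build K (subvs_of H) K^o *:%R f fL.
pose F : {linear subvs_of H -> K^o} := HB.pack f m.
apply: (PE (linfun F)) => h; rewrite lfunE /= /f; have [c ->] := hE h.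
by rewrite linearZ /= mulfK.
Qed.

End Weights.

(** * Brackets and nilpotency of root vectors *)

Section RootVectors.
Variables (K : numFieldType) (g : finLieAlgType K) (H : {vspace g}).
Local Notation weight := 'Hom(subvs_of H, K^o).
Implicit Types (a b c : weight) (x y z : g).

Lemma root_vector_lie a b x y :
  root_vector a x -> root_vector b y -> root_vector (a + b) (lie x y).
Proof.
move=> ax bY h; rewrite lie_derivation ax bY lieZl lieZr -scalerDl.
by rewrite add_lfunE.
Qed.

Lemma root_vectorZ a k x : root_vector a x -> root_vector a (k *: x).
Proof. by move=> ax h; rewrite lieZr ax !scalerA mulrC. Qed.

Lemma root_vectorB a x y :
  root_vector a x -> root_vector a y -> root_vector a (x - y).
Proof. by move=> ax ay h; rewrite lieBr ax ay scalerBr. Qed.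

Lemma root_vector_rootsP a x :
  root_vector a x -> a <> 0 -> x = 0 \/ roots H a.
Proof.
by move=> ax a0; have [|x0] := pselect (x = 0); [left|right; split; last exists x].
Qed.

Lemma root_vector_iter a b x y n : root_vector a x -> root_vector b y ->
  root_vector (b + a *+ n) (iter n (lie x) y).
Proof.
move=> ax bY; elim: n => [|n IHn]; first by rewrite addr0.
by rewrite mulrS addrCA; apply: root_vector_lie.
Qed.

(** Otherwise every [b + a *+ n] is a root or 0. In characteristic 0 these weights are pairwise
    distinct, while there are finitely many roots. *)
Lemma root_vector_iter0 a b x y : a <> 0 -> root_vector a x -> root_vector b y ->
  exists n, iter n (lie x) y = 0.
Proof.
move=> a0 ax bY; apply: contrapT => nex.
have sub n : (roots H `|` [set 0])%classic (b + a *+ n).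
  have [bn0|bn0] := pselect (b + a *+ n = 0); [by right|left].
  case: (root_vector_rootsP (root_vector_iter n ax bY) bn0) => // yn0.
  by case: nex; exists n.
apply: infinite_nat; have fin := @finite_roots K g H.
have := @finite_preimage _ _ (roots H `|` [set 0])%classic (fun n => b + a *+ n).
have -> : ((fun n => b + a *+ n) @^-1` (roots H `|` [set 0]) = [set: nat])%classic.
  by apply/seteqP; split => // n _; apply: sub.
apply; last by rewrite finite_setU; split.
move=> m n _ _ /addrI /eqP.
wlog le_mn : m n / (m <= n)%N.
  by move=> W E; have [/W->//|/ltnW/W->//] := leqP m n; rewrite eq_sym.
rewrite eq_sym -subr_eq0 -mulrnBr // => /eqP E.
case: (posnP (n - m)) => [|nm_gt0]; first lia.
case: a0; apply/lfunP => h; have := congr1 (fun f : weight => f h) E.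
rewrite -scaler_nat scale_lfunE zero_lfunE => /eqP.
by rewrite scaler_eq0 pnatr_eq0 -leqn0 leqNgt nm_gt0 => /eqP.
Qed.

End RootVectors.

(** * The invariant form on weight spaces *)

Section CartanRoots.
Variables (K : numFieldType) (g : finLieAlgType K) (H : {vspace g}).
Variables (B : g -> g -> K).
Local Notation weight := 'Hom(subvs_of H, K^o).
Implicit Types (a b c : weight) (x y z : g).
Hypotheses (gS : simple_lie g) (Hc : cartan_subalgebra H) (Bf : invariant_form B).

Lemma formDl x y z : B (x + y) z = B x z + B y z.
Proof. by have := form_linear Bf z 1 x y; rewrite scale1r mul1r. Qed.

Lemma form0l z : B 0 z = 0.
Proof. by apply: (addrI (B 0 z)); rewrite -formDl !addr0. Qed.

Lemma formZl k x z : B (k *: x) z = k * B x z.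
Proof. by have := form_linear Bf z k x 0; rewrite !addr0 form0l addr0. Qed.

Lemma formDr x y z : B x (y + z) = B x y + B x z.
Proof. by rewrite !(form_sym Bf x) formDl. Qed.

Lemma formZr k x z : B x (k *: z) = k * B x z.
Proof. by rewrite !(form_sym Bf x) formZl. Qed.

Lemma formNl x z : B (- x) z = - B x z.
Proof. by rewrite -scaleN1r formZl mulN1r. Qed.

Lemma formNr x z : B x (- z) = - B x z.
Proof. by rewrite -scaleN1r formZr mulN1r. Qed.

Lemma form0r x : B x 0 = 0.
Proof. by rewrite (form_sym Bf) form0l. Qed.

Lemma form_suml I r (P : pred I) (F : I -> g) z :
  B (\sum_(i <- r | P i) F i) z = \sum_(i <- r | P i) B (F i) z.
Proof. by elim/big_rec2: _ => [|i u v _ <-]; rewrite ?form0l ?formDl. Qed.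

Lemma form_sumr I r (P : pred I) (F : I -> g) z :
  B z (\sum_(i <- r | P i) F i) = \sum_(i <- r | P i) B z (F i).
Proof. by rewrite (form_sym Bf) form_suml; under eq_bigr do rewrite (form_sym Bf). Qed.

(** By invariance a central element is orthogonal to every bracket, and brackets span [g]. *)
Lemma center_eq0 x : (forall y, lie x y = 0) -> x = 0.
Proof.
move=> xC; apply: (form_nondegenerate Bf) => y.
have [s ->] := simple_perfect gS y; rewrite form_sumr big1 // => p _.
by rewrite -(form_invariant Bf) xC form0l.
Qed.

Lemma root_vector0E x : root_vector (0 : weight) x <-> x \in H.
Proof.
split=> [x0|xH h].
  apply: (cartan_maximal Hc) => h hH.
  by have := x0 (vsproj H h); rewrite vsprojK // zero_lfunE scale0r.
by rewrite zero_lfunE scale0r (cartan_abelian Hc) ?subvsP.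
Qed.

Lemma form_root_vector a b x y :
  root_vector a x -> root_vector b y -> a + b <> 0 -> B x y = 0.
Proof.
move=> ax bY ab; apply: contrapT => /eqP Bxy; apply: ab; apply/lfunP => h.
rewrite add_lfunE zero_lfunE; apply: (mulIf Bxy).
have := form_invariant Bf x (vsval h) y; rewrite lieC ax bY formNl formZl formZr.
by move=> E; rewrite mul0r mulrDl -E subrr.
Qed.

(** A root vector of weight [a] is orthogonal to all weight spaces except that of [- a], so
    nondegeneracy makes the latter nonzero. *)
Lemma roots_opp a : roots H a -> roots H (- a).
Proof.
move=> [a0 [x [x0 ax]]]; split; first by move/eqP; rewrite oppr_eq0 => /eqP.
apply: contrapT => nex; apply: x0; apply: (form_nondegenerate Bf).
apply: (weight_vector_ind Hc) => [b y bY|y z]; last by rewrite formDr => -> ->; rewrite addr0.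
have [ab|] := pselect (a + b = 0); last exact: form_root_vector ax bY.
have [->|y0] := pselect (y = 0); first by rewrite form0r.
by case: nex; exists y; split => //; rewrite (_ : - a = b) // -(addKr a b) ab addr0.
Qed.

(** [H] is orthogonal to every nonzero weight space, so the radical of the restricted form lies in
    the radical of [B]. *)
Lemma form_cartan_nondegenerate x :
  x \in H -> (forall y, y \in H -> B x y = 0) -> x = 0.
Proof.
move=> xH x0; apply: (form_nondegenerate Bf).
apply: (weight_vector_ind Hc) => [b y bY|y z]; last by rewrite formDr => -> ->; rewrite addr0.
have [b0|b0] := pselect (b = 0); first by apply: x0; apply/root_vector0E; rewrite -b0.
by apply: (form_root_vector _ bY (a := 0)); [apply/root_vector0E|rewrite add0r].
Qed.

End CartanRoots.

(** * Roots *)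

Section RootStructure.
Variables (K : numFieldType) (g : finLieAlgType K) (H : {vspace g}).
Variables (B : g -> g -> K) (X : 'Hom(subvs_of H, K^o) -> g).
Local Notation weight := 'Hom(subvs_of H, K^o).
Implicit Types (a b c : weight) (h : subvs_of H) (x y z : g).
Hypotheses (gS : simple_lie g) (Hc : cartan_subalgebra H) (Bf : invariant_form B).
Hypothesis HX : normalized_root_vectors B X.

Lemma weightN a h : a (- h) = - a h. Proof. exact: linearN. Qed.

Lemma weightB a h k : a (h - k) = a h - a k. Proof. exact: linearB. Qed.

Lemma weightZ a (t : K) h : a (t *: h) = t * a h. Proof. exact: linearZ. Qed.

Lemma root_vectorX a : roots H a -> root_vector a (X a).
Proof. by move=> /HX[]. Qed.

Lemma root_vectorXN a : roots H a -> root_vector (- a) (X (- a)).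
Proof. by move=> /(roots_opp Hc Bf) /HX[]. Qed.

Lemma root_neq0 a : roots H a -> a <> 0. Proof. by case. Qed.

Lemma formX a : roots H a -> B (X a) (X (- a)) = 1.
Proof. by move=> /HX[]. Qed.

Lemma rootX_neq0 a : roots H a -> X a != 0.
Proof.
by move=> /formX; apply: contra_eqN => /eqP ->; rewrite (form0l Bf) eq_sym oner_eq0.
Qed.

(* The element of [H] representing [a] through the form. *)
Definition root_dual a : subvs_of H := vsproj H (lie (X a) (X (- a))).

Lemma root_dualE a : roots H a -> vsval (root_dual a) = lie (X a) (X (- a)).
Proof.
move=> ra; rewrite vsprojK //; apply/(root_vector0E Hc).
rewrite -(subrr a); exact: root_vector_lie (root_vectorX ra) (root_vectorXN ra).
Qed.

Lemma form_lie_opp a x y h : root_vector a x -> root_vector (- a) y ->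
  B (lie x y) (vsval h) = a h * B x y.
Proof.
move=> ax ay; rewrite (form_invariant Bf) lieC ay (formNr Bf) (formZr Bf) opp_lfunE.
by rewrite mulNr opprK.
Qed.

Lemma form_root_dual a h : roots H a -> B (vsval (root_dual a)) (vsval h) = a h.
Proof.
move=> ra; rewrite root_dualE //.
by rewrite (form_lie_opp _ (root_vectorX ra) (root_vectorXN ra)) formX // mulr1.
Qed.

Lemma root_dual_eq a h : roots H a ->
  (forall k : subvs_of H, B (vsval h) (vsval k) = a k) -> h = root_dual a.
Proof.
move=> ra hE; apply/subvs_inj/eqP; rewrite -subr_eq0; apply/eqP.
apply: (form_cartan_nondegenerate Hc Bf) => [|y yH]; first by rewrite memvB ?subvsP.
rewrite -(vsprojK yH) (formDl Bf) (formNl Bf) hE form_root_dual //.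
exact: subrr.
Qed.

Lemma root_dualN a : roots H a -> root_dual (- a) = - root_dual a.
Proof.
move=> ra; apply/esym/root_dual_eq => [|k]; first exact: roots_opp Hc Bf _ ra.
by rewrite linearN (formNl Bf) form_root_dual // opp_lfunE.
Qed.

Lemma lie_root_dual a b y : root_vector b y -> roots H a ->
  lie (lie (X a) (X (- a))) y = b (root_dual a) *: y.
Proof. by move=> bY ra; rewrite -root_dualE. Qed.

(** Raise [y] by [X a] up to the last nonzero vector [v], of weight [b + a *+ q]; it is a highest
    weight vector on which [X (- a)] is nilpotent, so [sl2_highest] applies. *)
Lemma root_string a b y : roots H a -> root_vector b y -> y <> 0 ->
  exists r : int, b (root_dual a) = r%:~R / 2 * a (root_dual a).
Proof.
move=> ra bY y0; have ax := root_vectorX ra; have axN := root_vectorXN ra.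
have ex : exists n, iter n (lie (X a)) y == 0.
  by have [n /eqP] := root_vector_iter0 (root_neq0 ra) ax bY; exists n.
case: (ex_minnP ex) => -[|q] /eqP yq min; first by [].
set v := iter q (lie (X a)) y; have vb := root_vector_iter q ax bY.
have v0 : v != 0 by apply/negP => /min; rewrite ltnn.
have [n vn] := root_vector_iter0 (root_neq0 (roots_opp Hc Bf ra)) axN vb.
have hf : lie (lie (X a) (X (- a))) (X (- a)) = - a (root_dual a) *: X (- a).
  by rewrite (lie_root_dual axN) // opp_lfunE.
have [j] := sl2_highest (lie_root_dual vb ra) yq hf v0 vn.
rewrite add_lfunE -scaler_nat scale_lfunE => /eqP; rewrite -subr_eq0 => E.
(* The shift by [a *+ q] contributes [q], that is [2 q] halves, to the highest weight [j / 2]. *)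
exists (j%:Z - 2 * q%:Z); apply/eqP; rewrite -subr_eq0; apply: etrans E.
congr (_ == _); rewrite rmorphB rmorphM /= -!pmulrn.
rewrite -[q%:R *: a _]/(q%:R * a (root_dual a)).
move: (a _) (b _) => u w; rewrite /GRing.scale /=.
by field.
Qed.

(** If [a (root_dual a)] were 0, [root_string] would make every weight vanish on [root_dual a]. That
    vector would be central, hence 0, and so would [a]. *)
Lemma root_norm_neq0 a : roots H a -> a (root_dual a) != 0.
Proof.
move=> ra; apply: contra_notN (root_neq0 ra) => /eqP a0.
suff h0 : vsval (root_dual a) = 0.
  by apply/lfunP => h; rewrite zero_lfunE -form_root_dual // h0 (form0l Bf).
apply: (center_eq0 gS Bf); apply: (weight_vector_ind Hc) => [b y bY|y z]; last first.
  by rewrite lieDr => -> ->; rewrite addr0.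
have [->|y0] := pselect (y = 0); first by rewrite lie0r.
by have [r E] := root_string ra bY y0; rewrite bY E a0 mulr0 scale0r.
Qed.

(** This is [sl2_highest] with [X (- a)] as raising operator: a nonzero vector killed by [X (- a)]
    has weight [- j / 2] times [a (root_dual a)] with [j] natural, which cannot equal the positive
    multiple [n.+1]. *)
Lemma lowest_weight_eq0 a b y n : roots H a -> root_vector b y ->
  b (root_dual a) = n.+1%:R * a (root_dual a) -> lie (X (- a)) y = 0 -> y = 0.
Proof.
move=> ra bY bE ey; apply: contrapT => /eqP y0; have rN := roots_opp Hc Bf ra.
have [k yk] := root_vector_iter0 (root_neq0 ra) (root_vectorX ra) bY.
have hv := lie_root_dual bY rN.
have hf := lie_root_dual (root_vectorX ra) rN.
rewrite opprK root_dualN // weightN in hv; rewrite opprK root_dualN // weightN in hf.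
have [j] := sl2_highest hv ey hf y0 yk.
rewrite bE -mulNr => /(mulIf (root_norm_neq0 ra)) E.
have : (j%:R / 2 : K) < 0 by rewrite -E oppr_lt0 ltr0n.
by rewrite le_gtF ?divr_ge0 ?ler0n.
Qed.

(** The difference [w] of the two sides is orthogonal to [X (- a)]. Hence [lie w (X (- a))] is an
    element of [H] orthogonal to [H], so it is 0, and [w] is a lowest weight vector of positive
    weight. *)
Lemma root_space_dim1 a y : roots H a -> root_vector a y -> y = B y (X (- a)) *: X a.
Proof.
move=> ra ay; apply/eqP; rewrite -subr_eq0; apply/eqP.
set w := y - _; have aw : root_vector a w.
  by apply: root_vectorB => //; apply/root_vectorZ/root_vectorX.
apply: (lowest_weight_eq0 (n := 0) ra aw); first by rewrite mul1r.
have axN := root_vectorXN ra.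
suff w0 : lie w (X (- a)) = 0 by rewrite lieC w0 oppr0.
apply: (form_cartan_nondegenerate Hc Bf) => [|z zH].
  by apply/(root_vector0E Hc); rewrite -(subrr a); apply: root_vector_lie.
rewrite -(vsprojK zH) (form_lie_opp _ aw axN) (formDl Bf) (formNl Bf) (formZl Bf).
by rewrite formX // mulr1 subrr mulr0.
Qed.

(** For [y] of weight [a + a], the bracket [lie (X (- a)) y] is a multiple of [X a]. Its coefficient
    pairs [y] with [lie (X (- a)) (X (- a))], so it is 0 and [y] is a lowest weight vector. *)
Lemma root_double a : roots H a -> ~ roots H (a + a).
Proof.
move=> ra raa; have y0 := rootX_neq0 raa; have yaa := root_vectorX raa.
move: (X (a + a)) y0 yaa => y /eqP y0 yaa; apply: y0.
apply: (lowest_weight_eq0 (n := 1) ra yaa); first by rewrite add_lfunE mulr_natl mulr2n.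
have ay : root_vector a (lie (X (- a)) y).
  rewrite -[a in root_vector a](addKr a a).
  exact: root_vector_lie (root_vectorXN ra) yaa.
rewrite (root_space_dim1 ra ay) lieC (formNl Bf) (form_invariant Bf) liexx.
by rewrite (form0r Bf) oppr0 scale0r.
Qed.

(* With [c = r a], both [2 r] and [2 / r] are integers, hence [r] is one of
   [+-1/2, +-1, +-2]. *)
Lemma root_proportional a c : roots H a -> roots H c ->
  (forall h, a h = 0 -> c h = 0) -> c = a \/ c = - a.
Proof.
move=> ra rc ac; have sa := root_norm_neq0 ra; have sc := root_norm_neq0 rc.
have [m mE] := root_string ra (root_vectorX rc) (elimN eqP (rootX_neq0 rc)).
have [n nE] := root_string rc (root_vectorX ra) (elimN eqP (rootX_neq0 ra)).
(* Subtracting from [h] its component along [root_dual a] lands in the kernel of [a], where [c]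
   vanishes too. *)
have cE h : c h = m%:~R / 2 * a h.
  have := ac (h - (a h / a (root_dual a)) *: root_dual a).
  rewrite !weightB !weightZ divfK // subrr => /(_ erefl)/eqP.
  by rewrite subr_eq0 => /eqP ->; rewrite mE mulrCA divfK.
have mn : m * n = 4.
  apply: (@intr_inj K); rewrite rmorphM /=.
  have := cE (root_dual c); rewrite nE; move: sc; move: (c _) => u u0 E.
  by apply: (mulIf u0); rewrite [in RHS]E; field.
have n8 : n = 1 \/ n = 2 \/ n = 4 \/ n = -1 \/ n = -2 \/ n = -4.
  have [n_le n_ge] : n <= 4 /\ -4 <= n.
    have /(@dvdn_leq _ 4 isT) : (`|n| %| 4)%N.
      by apply/dvdnP; exists `|m|%N; rewrite -abszM mn.
    lia.
  have n3 k : k \in [:: 0; 3; -3 : int] -> n <> k.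
    by rewrite !inE => /or3P[] /eqP -> nk; move: mn; rewrite nk; lia.
  have := n3 0 isT; have := n3 3 isT; have := n3 (-3) isT; lia.
have a2 : c = a + a -> False by move=> E; move: rc; rewrite E; apply: root_double.
have aN2 : c = - a - a -> False.
  by move=> E; move: rc; rewrite E; apply/root_double/(roots_opp Hc Bf).
have c2 : a = c + c -> False by move=> E; move: ra; rewrite E; apply: root_double.
have cN2 : a = - c - c -> False.
  by move=> E; move: ra; rewrite E; apply/root_double/(roots_opp Hc Bf).
(* The ratio of [c] to [a] is [m / 2]. The values 2, -2, 1/2 and -1/2 are excluded by
   [root_double]. *)
case: n8 => [|[|[|[|[]]]]] n8; rewrite n8 in mn.
- have m4 : m = 4 by lia.
  case: a2; apply/lfunP => h; rewrite cE add_lfunE m4 /=.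
  by move: (a h) => u; field.
- left; have m2 : m = 2 by lia.
  by apply/lfunP => h; rewrite cE m2 mulfV ?mul1r // pnatr_eq0.
- case: c2; have m1 : m = 1 by lia.
  apply/lfunP => h; rewrite add_lfunE cE m1 /=.
  by move: (a h) => u; field.
- case: aN2; have m4 : m = -4 by lia.
  apply/lfunP => h; rewrite cE add_lfunE opp_lfunE m4 rmorphN /=.
  by move: (a h) => u; field.
- right; have m2 : m = -2 by lia.
  apply/lfunP => h; rewrite cE opp_lfunE m2 rmorphN /=.
  by move: (a h) => u; field.
- case: cN2; have m1 : m = -1 by lia.
  apply/lfunP => h; rewrite add_lfunE opp_lfunE cE m1 /= rmorphN /=.
  by move: (a h) => u; field.
Qed.

End RootStructure.

(** * Dual families for a nondegenerate pairing *)

Section DualFamily.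
Variables (K : fieldType) (V : vectType K) (F : V -> V -> K).
Hypotheses (Fl : forall y, scalar (F^~ y)) (Fr : forall x, scalar (F x)).
Variable S : {vspace V}.
Hypothesis FS : forall x, (forall y, y \in S -> F x y = 0) -> x = 0.

Let pair_fun (x : V) : V := \sum_(i < \dim S) F x (vbasis S)`_i *: (vbasis S)`_i.

Let pair_fun_linear : linear pair_fun.
Proof.
move=> k x y; rewrite /pair_fun scaler_sumr -big_split; apply: eq_bigr => i _.
by rewrite /= Fl scalerDl scalerA.
Qed.

Let pair_map : {linear V -> V} :=
  HB.pack pair_fun (GRing.isLinear.Build K V V *:%R pair_fun pair_fun_linear).

Let pair_map_ker : lker (linfun pair_map) == 0%VS.
Proof.
rewrite -subv0; apply/subvP => x; rewrite memv_ker lfunE /= memv0 => /eqP x0.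
apply/eqP/FS => y yS.
have Fx (i : 'I_(\dim S)) : F x (vbasis S)`_i = 0.
  by have /freeP/(_ (fun i : 'I_(\dim S) => F x (vbasis S)`_i) x0 i) := basis_free (vbasisP S).
pose m := GRing.isLinear.Build K V K *%R (F x) (Fr x).
pose Fx_lin : {scalar V} := HB.pack (F x) m.
rewrite -[F x y]/(Fx_lin y) (coord_vbasis yS) raddf_sum big1 // => i _.
by rewrite [LHS](linearZ_LR Fx_lin) /= Fx mulr0.
Qed.

(** [pair_map] records the values of [F x] on a basis of [S]. It is an injective map from the whole
    space into [S], so dimensions decide. *)
Lemma nondegenerate_full : S = fullv.
Proof.
apply/eqP; rewrite eqEdim subvf /= -(limg_dim_eq (f := linfun pair_map)); last first.
  by rewrite (eqP pair_map_ker) capv0.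
apply/dimvS/subvP => _ /memv_imgP[x _ ->]; rewrite lfunE /=.
by apply: memv_suml => i _; rewrite memvZ // vbasis_mem // mem_nth ?size_tuple.
Qed.

(** The vector dual to a basis element [y] is its preimage under the injective [pair_map]. *)
Lemma dual_family : exists s : seq (V * V), forall x, x = \sum_(p <- s) F x p.2 *: p.1.
Proof.
exists [seq ((linfun pair_map)^-1%VF y, y) | y <- vbasis S] => x.
rewrite big_map -[LHS](lker0_lfunK pair_map_ker) lfunE /= /pair_fun.
rewrite (big_nth 0) big_mkord size_tuple linear_sum.
by apply: eq_bigr => i _; rewrite linearZ.
Qed.

End DualFamily.

(** * Root space decomposition and the role of the rank *)

Section RootDecomposition.
Variables (K : numFieldType) (g : finLieAlgType K) (H : {vspace g}).
Variables (B : g -> g -> K) (X : 'Hom(subvs_of H, K^o) -> g).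
Local Notation weight := 'Hom(subvs_of H, K^o).
Implicit Types (a b c : weight) (h : subvs_of H) (x y z : g).
Hypotheses (gS : simple_lie g) (Hc : cartan_subalgebra H) (Bf : invariant_form B).
Hypothesis HX : normalized_root_vectors B X.
Local Notation root_dual := (root_dual X).

(** Otherwise [c] vanishes on the kernel of [b], and proportional roots are equal or opposite. *)
Lemma root_separation b c : roots H b -> roots H c -> c <> b -> c <> - b ->
  exists h, b h = 0 /\ c h = 1.
Proof.
move=> rb rc cb cNb; apply: contrapT => nex.
case: (root_proportional gS Hc Bf HX rb rc) => // h bh; apply: contrapT => /eqP ch.
by case: nex; exists ((c h)^-1 *: h); rewrite !weightZ bh mulr0 mulVf.
Qed.

Lemma root_vector_cases a y : root_vector a y -> a <> 0 ->
  y = 0 \/ roots H a /\ exists k : K, y = k *: X a.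
Proof.
move=> ay /(root_vector_rootsP ay)[|ra]; [by left|right; split => //].
by exists (B y (X (- a))); apply: (root_space_dim1 gS Hc Bf HX).
Qed.

Lemma root_ind (P : g -> Prop) : (forall h, P (vsval h)) ->
  (forall a (k : K), roots H a -> P (k *: X a)) ->
  (forall x y, P x -> P y -> P (x + y)) -> forall z, P z.
Proof.
move=> PH PX PD; apply: (weight_vector_ind Hc) => // a x ax.
have [a0|/(root_vector_cases ax)[->|[ra [k ->]]]] := pselect (a = 0).
- by rewrite -(vsprojK (_ : x \in H)) //; apply/(root_vector0E Hc); rewrite -a0.
- by rewrite (_ : 0 = vsval (0 : subvs_of H)) // linear0.
exact: PX.
Qed.

Lemma cartan_faithful h : (forall c, roots H c -> c h = 0) -> h = 0.
Proof.
move=> ch; apply/subvs_inj; rewrite linear0; apply: (center_eq0 gS Bf).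
apply: root_ind => [k|a k ra|x y]; last by rewrite lieDr => -> ->; rewrite addr0.
  by rewrite (cartan_abelian Hc) ?subvsP.
by rewrite lieZr (root_vectorX HX ra) ch // scale0r scaler0.
Qed.

Hypothesis rankH : (3 <= \dim H)%N.

(* Otherwise [X b], [X (- b)] and [root_dual b] span an ideal. *)
Lemma cartan_faithful_except b h : roots H b ->
  (forall c, roots H c -> c <> b -> c <> - b -> c h = 0) -> h = 0.
Proof.
move=> rb ch; apply: contrapT => h0.
have bh : b h <> 0.
  move=> bh; apply: h0; apply: cartan_faithful => c rc.
  have [->//|cb] := pselect (c = b); have [->|cNb] := pselect (c = - b).
    by rewrite opp_lfunE bh oppr0.
  exact: ch.
have rNb := roots_opp Hc Bf rb.
have XN := root_vectorXN Hc Bf HX rb; have Xb := root_vectorX HX rb.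
(* If [X c] and [X d] did not commute, [c + d] would be a root, different from [d] and [- d]. Both
   [c] and [c + d] would then vanish at [h], and so would [d]. *)
have commX c d : roots H c -> roots H d -> d h <> 0 ->
    (forall e, roots H e -> e <> d -> e <> - d -> e h = 0) ->
    c <> d -> c <> - d -> lie (X c) (X d) = 0.
  move=> rc rd dh eh cd cNd.
  have cd0 : c + d <> 0 by move/eqP; rewrite addr_eq0 => /eqP.
  have [//|[rcd _]] := root_vector_cases
    (root_vector_lie (root_vectorX HX rc) (root_vectorX HX rd)) cd0.
  suff : (c + d) h = 0 by rewrite add_lfunE eh // add0r => /dh.
  apply: eh => // E.
    by apply: (root_neq0 rc); rewrite -(addrK d c) E subrr.
  apply: (root_double gS Hc Bf HX (roots_opp Hc Bf rd)).
  by rewrite -{1}E addrK.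
pose t := vsval (root_dual b); pose I := <<[:: X b; X (- b); t]>>%VS.
have tE : t = lie (X b) (X (- b)) by rewrite /t (root_dualE Hc Bf HX).
have XI : X b \in I by rewrite memv_span // inE eqxx.
have XNI : X (- b) \in I by rewrite memv_span // !inE eqxx orbT.
have tI : t \in I by rewrite memv_span // !inE eqxx !orbT.
have gen_ideal x y : y \in [:: X b; X (- b); t] -> lie x y \in I.
  rewrite !inE; apply: (root_ind (P := fun x => _ -> lie x y \in I)) => [k|c k rc|u v uI vI yI].
  - case/or3P => /eqP ->; first by rewrite Xb memvZ.
      by rewrite XN memvZ.
    by rewrite (cartan_abelian Hc) ?mem0v ?subvsP.
  - rewrite lieZl => yI; rewrite memvZ //; move: yI.
    have tX d : roots H d -> lie (X d) t = - (d (root_dual b) *: X d).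
      by move=> rd; rewrite lieC /t (root_vectorX HX rd).
    have [->|cb] := pselect (c = b).
      case/or3P => /eqP ->; first by rewrite liexx mem0v.
        by rewrite -tE.
      by rewrite tX // memvN memvZ.
    have [->|cNb] := pselect (c = - b).
      case/or3P => /eqP ->; first by rewrite lieC -tE memvN.
        by rewrite liexx mem0v.
      by rewrite tX // memvN memvZ.
    have cXb : lie (X c) (X b) = 0 by apply: commX.
    have cXN : lie (X c) (X (- b)) = 0.
      apply: commX => //; last by rewrite opprK.
        by rewrite opp_lfunE => /eqP; rewrite oppr_eq0 => /eqP.
      by move=> e re eNb; rewrite opprK => eb; apply: ch.
    case/or3P => /eqP ->; rewrite ?cXb ?cXN ?mem0v //.
    by rewrite tE lie_derivation cXb cXN lie0l lie0r addr0 mem0v.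
  by rewrite lieDl memvD ?uI ?vI.
have ideal : lie_ideal I.
  move=> x; suff sub : (linfun (lie x) @: I <= I)%VS.
    by move=> y /(memv_img (linfun (lie x))) /(subvP sub); rewrite lfunE.
  rewrite limg_span; apply/span_subvP => _ /mapP[y yI ->].
  by rewrite lfunE gen_ideal.
have IT : I = fullv.
  case: (gS) => _ /(_ I ideal)[I0|//].
  have : X b \in I by rewrite memv_span // mem_head.
  by rewrite I0 memv0 (negPf (rootX_neq0 Bf HX rb)).
(* [I] is spanned by three vectors, so rank at least 3 leaves no room: [H] would be all of [g],
   which would be abelian. *)
have HT : H = fullv.
  apply/eqP; rewrite eqEdim subvf -IT /=; apply: leq_trans rankH.
  exact: dim_span.
case: (gS) => -[x [y nz]] _; apply: nz.
by apply: (cartan_abelian Hc); rewrite HT memvf.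
Qed.

(** An element of [H] orthogonal to these dual vectors is killed by every root other than [b] and
    [- b], hence is 0. Statements on [H] attached to [b] can thus be tested on brackets
    [lie (X c) (X (- c))] with [c] not proportional to [b]. *)
Lemma root_dual_span (b : weight) (P : subvs_of H -> Prop) : roots H b ->
  (forall c (k : K), roots H c -> c <> b -> c <> - b -> P (k *: root_dual c)) -> P 0 ->
  (forall h k, P h -> P k -> P (h + k)) -> forall h, P h.
Proof.
move=> rb Pc P0 PD h.
pose s := [seq root_dual c | c <- fset_set (roots H) & (c != b) && (c != - b)].
have sP h' : h' \in s <-> exists c, [/\ roots H c, c <> b, c <> - b & h' = root_dual c].
  split=> [/mapP[c]|[c [rc /eqP cb /eqP cNb ->]]].
    rewrite mem_filter => /andP[/andP[/eqP cb /eqP cNb]].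
    rewrite in_fset_set; last exact: finite_roots.
    by rewrite inE => rc ->; exists c.
  apply: map_f; rewrite mem_filter cb cNb in_fset_set; last exact: finite_roots.
  by rewrite inE.
have sT : <<s>>%VS = fullv.
  apply: (@nondegenerate_full _ _ (fun h k => B (vsval h) (vsval k))).
  - by move=> k t h1 h2; rewrite linearP /= (formDl Bf) (formZl Bf).
  - by move=> k t h1 h2; rewrite linearP /= (formDr Bf) (formZr Bf).
  move=> k k0; apply: (cartan_faithful_except rb) => c rc cb cNb.
  rewrite -(form_root_dual Hc Bf HX) // (form_sym Bf); apply: k0; apply: memv_span.
  by apply/sP; exists c.
have /coord_span -> : h \in <<in_tuple s>>%VS by rewrite /= sT memvf.
elim/big_rec: _ => // i x _; apply: PD.
have /sP[c [rc cb cNb ->]] : (in_tuple s)`_i \in s by apply: mem_nth.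
exact: Pc.
Qed.

End RootDecomposition.

(** * Equivariant bilinear maps *)

Section Equivariant.
Variables (K : fieldType) (g : lieAlgType K) (V : lmodType K) (act : g -> V -> V).

Record bilinear_map (phi : g -> g -> V) : Prop := {
  bilinearl : forall y, linear (phi^~ y);
  bilinearr : forall x, linear (phi x) }.

Record equivariant (phi : g -> g -> V) : Prop := {
  equi_bilinear :> bilinear_map phi;
  equi_act : forall z x y, act z (phi x y) = phi (lie z x) y + phi x (lie z y) }.

Variable phi : g -> g -> V.
Hypothesis phiE : bilinear_map phi.

Lemma bilinDl x y z : phi (x + y) z = phi x z + phi y z.
Proof. by have := bilinearl phiE z 1 x y; rewrite !scale1r. Qed.

Lemma bilinDr x y z : phi x (y + z) = phi x y + phi x z.
Proof. by have := bilinearr phiE x 1 y z; rewrite !scale1r. Qed.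

Lemma bilin0l z : phi 0 z = 0.
Proof. by apply: (addrI (phi 0 z)); rewrite -bilinDl !addr0. Qed.

Lemma bilin0r z : phi z 0 = 0.
Proof. by apply: (addrI (phi z 0)); rewrite -bilinDr !addr0. Qed.

Lemma bilinZl k x z : phi (k *: x) z = k *: phi x z.
Proof. by have := bilinearl phiE z k x 0; rewrite !addr0 bilin0l addr0. Qed.

Lemma bilinZr k x z : phi x (k *: z) = k *: phi x z.
Proof. by have := bilinearr phiE x k z 0; rewrite !addr0 bilin0r addr0. Qed.

Lemma bilinNl x z : phi (- x) z = - phi x z.
Proof. by rewrite -!scaleN1r bilinZl. Qed.

Lemma bilinNr x z : phi x (- z) = - phi x z.
Proof. by rewrite -!scaleN1r bilinZr. Qed.

Lemma bilin_sumr I r (P : pred I) (F : I -> g) z :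
  phi z (\sum_(i <- r | P i) F i) = \sum_(i <- r | P i) phi z (F i).
Proof. by elim/big_rec2: _ => [|i u v _ <-]; rewrite ?bilin0r ?bilinDr. Qed.

Lemma bilin_suml I r (P : pred I) (F : I -> g) z :
  phi (\sum_(i <- r | P i) F i) z = \sum_(i <- r | P i) phi (F i) z.
Proof. by elim/big_rec2: _ => [|i u v _ <-]; rewrite ?bilin0l ?bilinDl. Qed.

End Equivariant.

Lemma lie_equivariant (K : fieldType) (g : lieAlgType K) : equivariant (@lie K g) (@lie K g).
Proof.
by split; [split; [exact: lie_linearl|exact: lie_linearr]|exact: lie_derivation].
Qed.

(** * Equivariant forms determined by part of their values *)

Section EquivariantForms.
Variables (K : numFieldType) (g : finLieAlgType K) (H : {vspace g}).
Variables (B : g -> g -> K) (X : 'Hom(subvs_of H, K^o) -> g).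
Local Notation weight := 'Hom(subvs_of H, K^o).
Implicit Types (a b c : weight) (h : subvs_of H) (x y z : g).
Hypotheses (gS : simple_lie g) (Hc : cartan_subalgebra H) (Bf : invariant_form B).
Hypotheses (HX : normalized_root_vectors B X) (rankH : (3 <= \dim H)%N).
Local Notation root_dual := (root_dual X).

Let XvE a (ra : roots H a) := root_vectorX HX ra.
Let XNvE a (ra : roots H a) := root_vectorXN Hc Bf HX ra.
Let rdE a (ra : roots H a) := root_dualE Hc Bf HX ra.

Lemma exists_root : exists b, roots H b.
Proof.
apply: contrapT => nex; have inH z : z \in H.
  apply: (root_ind gS Hc Bf HX (P := fun z => z \in H)) => [h|a k ra|x y].
  - exact: subvsP.
  - by case: nex; exists a.
  exact: memvD.
by case: gS => -[x [y []]]; apply: (cartan_abelian Hc).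
Qed.

Lemma root_dual_ind (P : subvs_of H -> Prop) :
  (forall c (k : K), roots H c -> P (k *: root_dual c)) ->
  (forall h k, P h -> P k -> P (h + k)) -> forall h, P h.
Proof.
move=> Pc; have [b rb] := exists_root.
apply: (root_dual_span gS Hc Bf HX rankH rb) => [c k rc _ _|]; first exact: Pc.
by rewrite -(scale0r (root_dual b)); apply: Pc.
Qed.

Lemma lie_cartanX h a : roots H a -> lie (vsval h) (X a) = a h *: X a.
Proof. by move=> ra; rewrite XvE. Qed.

Lemma lieX_cartan h a : roots H a -> lie (X a) (vsval h) = - (a h *: X a).
Proof. by move=> ra; rewrite lieC XvE. Qed.

Lemma lieNX_cartan h a : roots H a -> lie (X (- a)) (vsval h) = a h *: X (- a).
Proof. by move=> ra; rewrite lieC XNvE // opp_lfunE scaleNr opprK. Qed.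

Lemma lieNXX a : roots H a -> lie (X (- a)) (X a) = - vsval (root_dual a).
Proof. by move=> ra; rewrite lieC rdE. Qed.

Lemma lie_cartan h h' : lie (vsval h) (vsval h') = 0.
Proof. by rewrite (cartan_abelian Hc) ?subvsP. Qed.

Section Values.
Variables (V : lmodType K) (act : g -> V -> V).
Hypothesis actL : forall z, linear (act z).

Let act0 z : act z 0 = 0.
Proof. by have := actL z (-1) 0 0; rewrite !scaleN1r oppr0 addr0 addNr. Qed.

Lemma bilinear_eq0 (phi : g -> g -> V) : bilinear_map phi ->
  (forall h h', phi (vsval h) (vsval h') = 0) ->
  (forall h a, roots H a -> phi (vsval h) (X a) = 0) ->
  (forall h a, roots H a -> phi (X a) (vsval h) = 0) ->
  (forall a b, roots H a -> roots H b -> phi (X a) (X b) = 0) ->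
  forall x y, phi x y = 0.
Proof.
move=> phiE HH HXr XH XX x y; move: x; apply: (root_ind gS Hc Bf HX) => [h|a k ra|u v]; last first.
- by rewrite (bilinDl phiE) => -> ->; rewrite addr0.
- rewrite (bilinZl phiE); suff -> : phi (X a) y = 0 by rewrite scaler0.
  move: y; apply: (root_ind gS Hc Bf HX) => [h|b l rb|u v]; first exact: XH.
    by rewrite (bilinZr phiE) XX ?scaler0.
  by rewrite (bilinDr phiE) => -> ->; rewrite addr0.
move: y; apply: (root_ind gS Hc Bf HX) => [k|b l rb|u v]; first exact: HH.
  by rewrite (bilinZr phiE) HXr ?scaler0.
by rewrite (bilinDr phiE) => -> ->; rewrite addr0.
Qed.

(** To reach [H], let [X c] act on the vanishing value [phi (X b) (X (- c))], with [c] different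
    from [b] and [- b]. One resulting term is again a value on non-opposite root vectors; the other
    is [phi (X b) (root_dual c)], and such dual vectors span [H]. *)
Lemma skew_equivariant_eq0 (phi : g -> g -> V) : equivariant act phi ->
  (forall x y, phi x y = - phi y x) ->
  (forall b c, roots H b -> roots H c -> b <> - c -> phi (X b) (X c) = 0) ->
  forall x y, phi x y = 0.
Proof.
move=> phiE skew XX.
have XH h b : roots H b -> phi (X b) (vsval h) = 0.
  move=> rb; move: h; apply: (root_dual_span gS Hc Bf HX rankH rb) => [c k rc cb cNb||h k].
  - rewrite linearZ /= (bilinZr phiE) rdE //.
    have := equi_act phiE (X c) (X b) (X (- c)).
    have rNc := roots_opp Hc Bf rc.
    rewrite XX // ?opprK; last exact/nesym.
    rewrite act0 => /esym/eqP; rewrite addr_eq0 => /eqP E.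
    suff E0 : phi (lie (X c) (X b)) (X (- c)) = 0.
      by move/eqP: E; rewrite E0 eq_sym oppr_eq0 => /eqP ->; rewrite scaler0.
    have cb0 : c + b <> 0 by move/eqP; rewrite addr_eq0 => /eqP.
    have [->|[rcb [l ->]]] := root_vector_cases gS Hc Bf HX
      (root_vector_lie (XvE rc) (XvE rb)) cb0; first exact: bilin0l phiE _.
    rewrite (bilinZl phiE) XX ?scaler0 // opprK => E1.
    by apply: (root_neq0 rb); rewrite -(addKr c b) E1 addNr.
  - by rewrite linear0 (bilin0r phiE).
  by rewrite linearD /= (bilinDr phiE) => -> ->; rewrite addr0.
(* Let [X (- b)] act on [phi (X b) h = 0]. *)
have rdH b h : roots H b -> phi (vsval (root_dual b)) (vsval h) = b h *: phi (X b) (X (- b)).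
  move=> rb; have := equi_act phiE (X (- b)) (X b) (vsval h).
  rewrite XH // act0 lieNXX // lieNX_cartan // (bilinNl phiE) (bilinZr phiE).
  by move/esym/eqP; rewrite addrC subr_eq0 => /eqP.
(* At [h = root_dual b] the left side of [rdH] is 0 by skewness, while [b (root_dual b)] is not. *)
have XX0 b : roots H b -> phi (X b) (X (- b)) = 0.
  move=> rb; have /eqP := rdH b (root_dual b) rb.
  have -> : phi (vsval (root_dual b)) (vsval (root_dual b)) = 0.
    have /eqP := skew (vsval (root_dual b)) (vsval (root_dual b)).
    rewrite -addr_eq0 -mulr2n -scaler_nat scaler_eq0 pnatr_eq0 /= => /eqP //.
  rewrite eq_sym scaler_eq0 => /orP[|/eqP//].
  by rewrite (negPf (root_norm_neq0 gS Hc Bf HX rb)).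
apply: (bilinear_eq0 phiE) => [h k|h a ra|//|a b ra rb].
- move: h; apply: root_dual_ind => [c l rc|h h']; last first.
    by rewrite linearD /= (bilinDl phiE) => -> ->; rewrite addr0.
  by rewrite linearZ /= (bilinZl phiE) rdH // XX0 // !scaler0.
- by rewrite skew XH // oppr0.
have [->|] := pselect (b = - a); first exact: XX0.
by move=> bNa; apply: XX => // E; apply: bNa; rewrite E opprK.
Qed.

(* [T] need not be equivariant: only its values on root vectors matter. *)
Section Determined.
Variables (phi : g -> g -> V) (T : {linear g -> V}).
Hypothesis phiE : equivariant act phi.
Hypothesis phiHX : forall h b, roots H b -> phi (vsval h) (X b) = b h *: T (X b).

Lemma determined_cartan_root h b y : root_vector b y -> b <> 0 ->
  phi (vsval h) y = b h *: T y.
Proof.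
move=> bY /(root_vector_cases gS Hc Bf HX bY)[->|[rb [k ->]]].
  by rewrite (bilin0r phiE) linear0 scaler0.
by rewrite (bilinZr phiE) phiHX // (linearZ_LR T) /= !scalerA mulrC.
Qed.

(** Take [h] with [b h = 0] and [c h = 1]. Then [phi h y = 0], and letting [x] act on it gives
    [phi x y = phi h (lie x y)], which [T] determines since [c + b] takes the value 1 at [h]. *)
Lemma determined_roots c b x y : root_vector c x -> root_vector b y ->
  c <> 0 -> b <> 0 -> c <> b -> c <> - b -> phi x y = T (lie x y).
Proof.
move=> cx bY c0 b0 cb cNb.
have [->|[rc _]] := root_vector_cases gS Hc Bf HX cx c0.
  by rewrite (bilin0l phiE) lie0l linear0.
have [->|[rb _]] := root_vector_cases gS Hc Bf HX bY b0.
  by rewrite (bilin0r phiE) lie0r linear0.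
have [h [bh ch]] := root_separation gS Hc Bf HX rb rc cb cNb.
have := equi_act phiE x (vsval h) y.
rewrite (determined_cartan_root h bY b0) bh scale0r act0 lieC cx ch scale1r.
rewrite (bilinNl phiE) => /esym/eqP; rewrite addrC subr_eq0 => /eqP <-.
rewrite (determined_cartan_root h (root_vector_lie cx bY)).
  by rewrite add_lfunE ch bh addr0 scale1r.
by move/eqP; rewrite addr_eq0 => /eqP.
Qed.

(** Partial equivariance of [T]: let [x] act on [T y = phi h y] with [b h = 1]. The coefficients
    [- c h] and [c h + b h] add up to 1. *)
Lemma determined_act c b x y : root_vector c x -> root_vector b y ->
  c <> 0 -> b <> 0 -> c <> b -> c <> - b -> act x (T y) = T (lie x y).
Proof.
move=> cx bY c0 b0 cb cNb.
have [h bh] : exists h, b h = 1.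
  apply: contrapT => nex; apply: b0; apply/lfunP => h; rewrite zero_lfunE.
  by apply: contrapT => /eqP bh; apply: nex; exists ((b h)^-1 *: h); rewrite weightZ mulVf.
have := equi_act phiE x (vsval h) y.
rewrite (determined_cartan_root h bY b0) bh scale1r => ->.
rewrite lieC cx (bilinNl phiE) (bilinZl phiE) (determined_roots cx bY) //.
rewrite (determined_cartan_root h (root_vector_lie cx bY)).
  by rewrite add_lfunE bh scalerDl scale1r addrA addNr add0r.
by move/eqP; rewrite addr_eq0 => /eqP.
Qed.

(** By [root_dual_span] one may replace [h] by [lie (X c) (X (- c))]. When [X c] acts on
    [phi (X b) (X (- c))], all the other terms are covered by [determined_roots] and
    [determined_act]. *)
Lemma determined_root_cartan b h : roots H b -> phi (X b) (vsval h) = T (lie (X b) (vsval h)).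
Proof.
move=> rb; move: h; apply: (root_dual_span gS Hc Bf HX rankH rb) => [c k rc cb cNb||h k].
- rewrite linearZ /= (bilinZr phiE) lieZr linearZ; congr (_ *: _); rewrite rdE //.
  have b0 := root_neq0 rb; have c0 := root_neq0 rc.
  have rNc := roots_opp Hc Bf rc; have Nc0 := root_neq0 rNc.
  have Ncb : b <> - - c by rewrite opprK; apply/nesym.
  have bNc : b <> - c by move=> E; apply: cNb; rewrite E opprK.
  have bc0 : b - c <> 0 by move/eqP; rewrite subr_eq0 => /eqP/esym.
  have cb0 : c + b <> 0 by move/eqP; rewrite addr_eq0 => /eqP.
  have E1 : act (X c) (phi (X b) (X (- c))) = T (lie (X c) (lie (X b) (X (- c)))).
    rewrite (determined_roots (XvE rb) (XNvE rc)) //.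
    have bcv := root_vector_lie (XvE rb) (XNvE rc).
    have [->|[rbc _]] := root_vector_cases gS Hc Bf HX bcv bc0.
      by rewrite lie0r linear0 act0.
    apply: (determined_act (XvE rc) bcv) => // [E|].
      apply: (root_double gS Hc Bf HX rc); rewrite {2}E addrC subrK //.
    by rewrite opprB => E; apply: b0; rewrite -(subKr c b) -E subrr.
  have E2 : phi (lie (X c) (X b)) (X (- c)) = T (lie (lie (X c) (X b)) (X (- c))).
    have cbv := root_vector_lie (XvE rc) (XvE rb).
    have [->|[rcb _]] := root_vector_cases gS Hc Bf HX cbv cb0.
      by rewrite (bilin0l phiE) lie0l linear0.
    apply: (determined_roots cbv (XNvE rc)) => //; rewrite ?opprK => E.
      apply: (root_double gS Hc Bf HX rNc); rewrite -{1}E addrAC subrr add0r //.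
    by apply: b0; rewrite -(addKr c b) E addNr.
  have := equi_act phiE (X c) (X b) (X (- c)); rewrite E1 E2.
  by rewrite lie_derivation linearD => /addrI ->.
- by rewrite linear0 (bilin0r phiE) lie0r linear0.
by rewrite linearD /= (bilinDr phiE) lieDr linearD => -> ->.
Qed.

End Determined.

End Values.

End EquivariantForms.

(** * The Casimir operator *)

Section Casimir.
Variables (K : numFieldType) (g : finLieAlgType K) (H : {vspace g}).
Variables (B : g -> g -> K) (X : 'Hom(subvs_of H, K^o) -> g).
Local Notation weight := 'Hom(subvs_of H, K^o).
Implicit Types (a b c : weight) (h : subvs_of H) (x y z : g).
Hypotheses (gS : simple_lie g) (Hc : cartan_subalgebra H) (Bf : invariant_form B).
Hypotheses (HX : normalized_root_vectors B X) (rankH : (3 <= \dim H)%N).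
Local Notation root_dual := (root_dual X).
Local Notation Phi := (fset_set (roots H)).

Lemma mem_roots a : a \in Phi -> roots H a.
Proof. by rewrite in_fset_set ?inE //; apply: finite_roots. Qed.

Lemma roots_mem a : roots H a -> a \in Phi.
Proof. by move=> ra; rewrite in_fset_set ?inE //; apply: finite_roots. Qed.

Lemma form_XN a b : roots H a -> roots H b -> B (X b) (X (- a)) = (b == a)%:R.
Proof.
move=> ra rb; have [->|ba] := eqVneq b a; first exact: (formX HX).
apply: (form_root_vector Bf (root_vectorX HX rb) (root_vectorXN Hc Bf HX ra)).
by apply/eqP; rewrite subr_eq0.
Qed.

Lemma form_cartanX h a : roots H a -> B (vsval h) (X a) = 0.
Proof.
move=> ra; apply: (form_root_vector (a := (0 : weight)) Bf _ (root_vectorX HX ra)).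
  by apply/(root_vector0E Hc)/subvsP.
by rewrite add0r; apply: root_neq0.
Qed.

Lemma sum_form_roots (V : lmodType K) (u : weight -> V) b : roots H b ->
  \sum_(a <- Phi) B (X b) (X (- a)) *: u a = u b.
Proof.
move=> rb; rewrite (bigD1_seq b) ?roots_mem //= ?fset_uniq //.
rewrite form_XN // eqxx scale1r big_seq_cond big1 ?addr0 // => a /andP[ra ab].
by rewrite (form_XN (mem_roots ra) rb) eq_sym (negPf ab) scale0r.
Qed.

Lemma sum_form_cartan (V : lmodType K) (u : weight -> V) h :
  \sum_(a <- Phi) B (vsval h) (X (- a)) *: u a = 0.
Proof.
rewrite big_seq big1 // => a ra; rewrite form_cartanX ?scale0r //.
exact/(roots_opp Hc Bf)/mem_roots.
Qed.

(** The form pairs [H] with itself and the space of [a] with that of [- a], so dual families of [H]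
    are completed by the pairs [(X a, X (- a))]. *)
Lemma dual_bases : exists s : seq (subvs_of H * subvs_of H),
  forall x, x = \sum_(p <- s) B x (vsval p.2) *: vsval p.1 +
                \sum_(a <- Phi) B x (X (- a)) *: X a.
Proof.
have [||h hn|s sE] := @dual_family K (subvs_of H) (fun h k => B (vsval h) (vsval k)) _ _ fullv.
- by move=> k t h1 h2; rewrite linearP /= (formDl Bf) (formZl Bf).
- by move=> k t h1 h2; rewrite linearP /= (formDr Bf) (formZr Bf).
- apply/subvs_inj; rewrite linear0.
  apply: (form_cartan_nondegenerate Hc Bf) => [|y yH]; first exact: subvsP.
  by rewrite -(vsprojK yH); apply: hn; rewrite memvf.
exists s; apply: (root_ind gS Hc Bf HX) => [h|a k ra|x y xE yE].
- rewrite sum_form_cartan addr0 {1}[h]sE linear_sum.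
  by apply: eq_bigr => p _; rewrite linearZ.
- rewrite big1 ?add0r => [|p _].
    under eq_bigr do rewrite (formZl Bf) -scalerA.
    by rewrite -scaler_sumr sum_form_roots.
  by rewrite (form_sym Bf) (formZr Bf) form_cartanX // mulr0 scale0r.
rewrite {1}xE {1}yE addrACA -!big_split.
by congr (_ + _); apply: eq_bigr => p _; rewrite (formDl Bf) scalerDl.
Qed.

Variable s : seq (subvs_of H * subvs_of H).
(** The sum of [p.1] tensor [p.2] over these dual pairs is the Casimir tensor. *)
Let bases := [seq (vsval p.1, vsval p.2) | p <- s] ++ [seq (X a, X (- a)) | a <- Phi].
Hypothesis sE : forall x, x = \sum_(p <- s) B x (vsval p.2) *: vsval p.1 +
                \sum_(a <- Phi) B x (X (- a)) *: X a.

Let bases_l x : x = \sum_(p <- bases) B x p.2 *: p.1.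
Proof. by rewrite big_cat !big_map; apply: sE. Qed.

Let bases_r y : y = \sum_(p <- bases) B p.1 y *: p.2.
Proof.
apply/eqP; rewrite -subr_eq0; apply/eqP; apply: (form_nondegenerate Bf) => x.
rewrite (formDl Bf) (formNl Bf) (form_suml Bf) (form_sym Bf y) {1}[x]bases_l (form_suml Bf).
apply/eqP; rewrite subr_eq0; apply/eqP/eq_bigr => p _.
by rewrite !(formZl Bf) mulrC (form_sym Bf x).
Qed.

Section CasimirTensor.
Variables (V : lmodType K) (act : g -> V -> V).
Hypothesis actL : forall z, linear (act z).

Let actS z I (r : seq I) (F : I -> V) :
  act z (\sum_(i <- r) F i) = \sum_(i <- r) act z (F i).
Proof.
have aD u v : act z (u + v) = act z u + act z v.
  by have := actL z 1 u v; rewrite !scale1r.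
have a0 : act z 0 = 0 by apply: (addrI (act z 0)); rewrite -aD !addr0.
exact: (big_morph _ aD a0).
Qed.

Variable phi : g -> g -> V.
Hypothesis phiE : equivariant act phi.

(** [phi] composed with [z |-> sum of p.1 tensor (lie p.2 z)]. For [phi] the bracket this is the
    Casimir operator of the adjoint representation, so up to its eigenvalue the inner map is a
    section of the bracket. *)
Definition casimir (z : g) : V := \sum_(p <- bases) phi p.1 (lie p.2 z).

Lemma casimir_linear : linear casimir.
Proof.
move=> k x y; rewrite /casimir scaler_sumr -big_split; apply: eq_bigr => p _.
by rewrite /= linearP (bilinearr phiE).
Qed.

Definition casimir_map : {linear g -> V} :=
  HB.pack casimir (GRing.isLinear.Build K g V *:%R casimir casimir_linear).

Lemma casimir_act w z : act w (casimir_map z) = casimir_map (lie w z).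
Proof.
rewrite /casimir_map /= /casimir actS.
under eq_bigr do rewrite (equi_act phiE) (lie_derivation w) (bilinDr phiE) addrA.
rewrite big_split /= -[RHS]add0r; congr (_ + _).
rewrite big_split /=; apply/eqP; rewrite addr_eq0; apply/eqP.
(* Invariance of the Casimir tensor: expanding [lie w p.1] and [lie w q.2] in the dual families
   gives coefficients that are opposite by invariance of [B]. *)
under eq_bigr => p _ do rewrite [lie w p.1]bases_l (bilin_suml phiE).
rewrite exchange_big -sumrN; apply: eq_bigr => q _ /=.
rewrite [lie w q.2]bases_r lie_suml (bilin_sumr phiE) -sumrN; apply: eq_bigr => p _.
rewrite (bilinZl phiE) lieZl (bilinZr phiE) -scaleNr; congr (_ *: _).
by rewrite lieC (formNl Bf) (form_invariant Bf).
Qed.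

End CasimirTensor.

Let Omega := casimir_map (lie_equivariant g).

Let Omega_lie w z : lie w (Omega z) = Omega (lie w z).
Proof. exact: (casimir_act (@lie_linearr K g)). Qed.

(* Schur's lemma, starting from the eigenvector [X b]. *)
Lemma casimir_scalar : exists c : K, forall z, Omega z = c *: z.
Proof.
have [b rb] := exists_root gS Hc Bf HX; pose c := B (Omega (X b)) (X (- b)).
have cE : Omega (X b) = c *: X b.
  apply: (root_space_dim1 gS Hc Bf HX rb) => h.
  by rewrite Omega_lie (root_vectorX HX rb) (linearZ_LR Omega).
exists c; pose I := lker (linfun Omega - c *: \1)%VF.
have inI z : (z \in I) = (Omega z == c *: z).
  by rewrite memv_ker add_lfunE opp_lfunE scale_lfunE id_lfunE lfunE subr_eq0.
have ideal : lie_ideal I.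
  by move=> x y; rewrite !inI => /eqP yE; rewrite -Omega_lie yE lieZr.
case: gS => _ /(_ I ideal)[I0|IT] z; last by apply/eqP; rewrite -inI IT memvf.
have : X b \in I by rewrite inI cE.
by rewrite I0 memv0 (negPf (rootX_neq0 Bf HX rb)).
Qed.

(* On [H] the Casimir operator represents the form [sum_a a(h) a(k)], which is
   positive on [root_dual b] because the numbers [2 (a, b) / (b, b)] are integers. *)
Lemma casimir_neq0 (c : K) : (forall z, Omega z = c *: z) -> c != 0.
Proof.
move=> OmegaE; have [b rb] := exists_root gS Hc Bf HX.
apply: contraT; rewrite negbK => /eqP c0.
have := congr1 (fun z => B z (vsval (root_dual b))) (OmegaE (vsval (root_dual b))).
rewrite c0 scale0r (form0l Bf) /Omega /= /casimir big_cat /= !big_map.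
(* The pairs from [H] contribute nothing, [H] being abelian. *)
rewrite big1 ?add0r => [|p _]; last by rewrite /= (lie_cartan Hc) lie0r.
have /choice[r rE] a : exists r : int, roots H a ->
    a (root_dual b) = r%:~R / 2 * b (root_dual b).
  have [ra|] := pselect (roots H a); last by exists 0.
  have [r E] := root_string Hc Bf HX rb (root_vectorX HX ra) (elimN eqP (rootX_neq0 Bf HX ra)).
  by exists r.
rewrite (form_suml Bf) big_seq.
under eq_bigr => a /mem_roots ra.
  rewrite (lieNX_cartan Hc Bf HX) // lieZr (formZl Bf) -(root_dualE Hc Bf HX) //.
  rewrite (form_root_dual Hc Bf HX) // rE // mulrACA.
  over.
(* With the square of [b (root_dual b)] factored out, a sum of squares of the half-integers
   [r a / 2] remains; its term at [b] is nonzero. *)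
rewrite -big_seq -mulr_suml => /eqP; rewrite !mulf_eq0 orbb.
rewrite (negPf (root_norm_neq0 gS Hc Bf HX rb)) orbF psumr_eq0 => [|a _].
  move/allP/(_ b (roots_mem rb)); rewrite /= mulf_eq0 orbb => /eqP r0.
  have := rE b rb; rewrite r0 mul0r => /eqP.
  by rewrite (negPf (root_norm_neq0 gS Hc Bf HX rb)).
rewrite -expr2 exprMn -rmorphXn /=; apply: mulr_ge0; last by rewrite exprn_ge0 ?invr_ge0 ?ler0n.
by rewrite ler0z sqr_ge0.
Qed.

End Casimir.

(** * Splitting an equivariant form into a bracket part and an invariant part *)

Section Decomposition.
Variables (K : numFieldType) (g : finLieAlgType K) (H : {vspace g}).
Variables (B : g -> g -> K) (X : 'Hom(subvs_of H, K^o) -> g).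
Local Notation weight := 'Hom(subvs_of H, K^o).
Implicit Types (a b c : weight) (h : subvs_of H) (x y z : g).
Hypotheses (gS : simple_lie g) (Hc : cartan_subalgebra H) (Bf : invariant_form B).
Hypotheses (HX : normalized_root_vectors B X) (rankH : (3 <= \dim H)%N).
Local Notation root_dual := (root_dual X).
Local Notation Phi := (fset_set (roots H)).

Variables (V : lmodType K) (act : g -> V -> V) (phi : g -> g -> V).
Hypotheses (actL : forall z, linear (act z)) (phiE : equivariant act phi).
Hypothesis phi_cartan : forall h (h' : subvs_of H) z,
  phi (vsval h) (lie (vsval h') z) = phi (vsval h') (lie (vsval h) z).

Let act0 z : act z 0 = 0.
Proof. by have := actL z (-1) 0 0; rewrite !scaleN1r oppr0 addr0 addNr. Qed.

(** The value that [T] must take on [X a], forced by [phi h (X a) = a h *: T (X a)] at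
    [h = root_dual a]. [T1] extends these values by 0 on [H]. *)
Let T0 a : V := (a (root_dual a))^-1 *: phi (vsval (root_dual a)) (X a).
Let T1_fun x : V := \sum_(a <- Phi) B x (X (- a)) *: T0 a.

Let T1_linear : linear T1_fun.
Proof.
move=> k x y; rewrite /T1_fun scaler_sumr -big_split; apply: eq_bigr => a _.
by rewrite /= (formDl Bf) (formZl Bf) scalerDl -scalerA.
Qed.

Let T1 : {linear g -> V} := HB.pack T1_fun (GRing.isLinear.Build K g V *:%R T1_fun T1_linear).

(** [T0] only settles [h = root_dual b]; the hypothesis [phi_cartan] carries the relation to all
    other [h]. *)
Let T1_phi h b : roots H b -> phi (vsval h) (X b) = b h *: T1 (X b).
Proof.
move=> rb; rewrite /T1 /= /T1_fun (sum_form_roots Hc Bf HX) // /T0 scalerA.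
have := phi_cartan h (root_dual b) (X b).
rewrite !(lie_cartanX HX) // !(bilinZr phiE) => E.
by rewrite mulrC -scalerA -E scalerA mulVf ?scale1r // (root_norm_neq0 gS Hc Bf HX).
Qed.

(** [T] is [phi] applied to the Casimir section, divided by the Casimir eigenvalue, hence
    equivariant. At [X b] each summand [phi p.1 (lie p.2 (X b))] equals [T1] of the corresponding
    double bracket, and these add up to the eigenvalue times [X b]. *)
Let T_exists : exists T : {linear g -> V},
  (forall z x, act z (T x) = T (lie z x)) /\ forall b, roots H b -> T (X b) = T1 (X b).
Proof.
have [s sE] := dual_bases gS Hc Bf HX.
have [c cE] := casimir_scalar gS Hc Bf HX sE.
have c0 := casimir_neq0 gS Hc Bf HX cE.
pose T z : V := c^-1 *: casimir_map X s phiE z.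
have TL : linear T by move=> k x y; rewrite /T linearP scalerDr !scalerA mulrC.
pose T' : {linear g -> V} := HB.pack T (GRing.isLinear.Build K g V *:%R T TL).
exists T'; split=> /= [z x|b rb].
  rewrite /T -(casimir_act Bf sE actL).
  by have := actL z c^-1 (casimir_map X s phiE x) 0; rewrite !addr0 act0 addr0.
suff E : casimir_map X s phiE (X b) = T1 (casimir_map X s (lie_equivariant g) (X b)).
  by rewrite /T E cE (linearZ_LR T1) /= scalerA mulVf ?scale1r.
rewrite -[casimir_map _ _ _ _]/(casimir X s phi (X b)).
rewrite -[casimir_map _ _ _ _]/(casimir X s (@lie K g) (X b)).
rewrite /casimir (linear_sum T1) !big_cat !big_map; congr (_ + _).
  apply: eq_bigr => p _; rewrite [in LHS](lie_cartanX HX) // (bilinZr phiE) T1_phi //.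
  by rewrite [in RHS](lie_cartanX HX) // lieZr (lie_cartanX HX) // !(linearZ_LR T1).
rewrite [LHS]big_seq [RHS]big_seq; apply: eq_bigr => a /mem_roots ra.
have rNa := roots_opp Hc Bf ra.
have [->|bNa] := pselect (b = - a); first by rewrite liexx (bilin0r phiE) lie0r linear0.
have [<-|ba] := pselect (b = a).
  rewrite (lieNXX Hc Bf HX) // (bilinNr phiE) lieNr linearN; congr (- _).
  exact: (determined_root_cartan gS Hc Bf HX rankH actL phiE T1_phi).
have Nab := root_vector_lie (root_vectorX HX rNa) (root_vectorX HX rb).
have Nab0 : - a + b <> 0 by rewrite addrC => /eqP; rewrite subr_eq0 => /eqP.
have [->|[rNab _]] := root_vector_cases gS Hc Bf HX Nab Nab0.
  by rewrite (bilin0r phiE) lie0r linear0.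
apply: (determined_roots gS Hc Bf HX actL phiE T1_phi (root_vectorX HX ra) Nab) => //.
- exact: root_neq0 ra.
- move=> E; apply: (root_double gS Hc Bf HX ra).
  by rewrite {1}E addrAC addNr add0r.
rewrite opprD opprK => E; apply: (root_neq0 rb).
by apply/eqP; rewrite -oppr_eq0 -(addKr a (- b)) -E addNr.
Qed.

(* After subtracting [T \o lie] only the pairings of opposite weight spaces
   remain, and their values are invariant. *)
Theorem equivariant_decomposition : exists (T : {linear g -> V}) (theta : g -> g -> V),
  [/\ forall z x, act z (T x) = T (lie z x), equivariant act theta,
      forall x y, theta x y = theta y x,
      forall x y z, theta (lie x y) z = theta x (lie y z) &
      forall x y, phi x y = T (lie x y) + theta x y].
Proof.
have [T [TE TX]] := T_exists; pose theta x y := phi x y - T (lie x y).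
have thE : equivariant act theta.
  split=> [|z x y]; first split=> [y k x x'|x k y y']; rewrite /theta.
  - by rewrite (bilinDl phiE) (bilinZl phiE) lieDl lieZl linearP scalerBr opprD addrACA.
  - by rewrite (bilinDr phiE) (bilinZr phiE) linearP linearP scalerBr opprD addrACA.
  have aB u v : act z (u - v) = act z u - act z v.
    by have := actL z (-1) v u; rewrite !scaleN1r ![- _ + _]addrC.
  by rewrite aB TE (equi_act phiE) lie_derivation linearD opprD addrACA.
(* The determination lemmas apply to [theta] with the zero map in place of [T], and so become
   vanishing statements. *)
have th_HX h b : roots H b -> theta (vsval h) (X b) = b h *: (\0 : {linear g -> V}) (X b).
  by move=> rb; rewrite /theta T1_phi // (lie_cartanX HX) // linearZ TX // subrr scaler0.
have thD x y : phi x y = T (lie x y) + theta x y by rewrite /theta addrC subrK.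
clearbody theta.
have thHX h b : roots H b -> theta (vsval h) (X b) = 0.
  by move=> rb; rewrite th_HX // scaler0.
have thXH h b : roots H b -> theta (X b) (vsval h) = 0.
  by move=> rb; rewrite (determined_root_cartan gS Hc Bf HX rankH actL thE th_HX).
have thHXN h b : roots H b -> b h *: theta (X (- b)) (X b) = theta (vsval h) (vsval (root_dual b)).
  move=> rb; have := equi_act thE (X (- b)) (vsval h) (X b).
  rewrite thHX // act0 (lieNX_cartan Hc Bf HX) // (lieNXX Hc Bf HX) //.
  by rewrite (bilinZl thE) (bilinNr thE) => /esym/eqP; rewrite subr_eq0 => /eqP.
have thXNH h b : roots H b -> b h *: theta (X b) (X (- b)) = theta (vsval (root_dual b)) (vsval h).
  move=> rb; have := equi_act thE (X (- b)) (X b) (vsval h).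
  rewrite thXH // act0 (lieNX_cartan Hc Bf HX) // (lieNXX Hc Bf HX) //.
  by rewrite (bilinZr thE) (bilinNl thE) => /esym/eqP; rewrite addrC subr_eq0 => /eqP.
have norm0 b : roots H b -> b (root_dual b) != 0 by move=> rb; apply: (root_norm_neq0 gS Hc Bf HX).
(* Both values, multiplied by [b (root_dual b)], give [theta] on the pair formed by [root_dual b]
   twice. *)
have thN b : roots H b -> theta (X (- b)) (X b) = theta (X b) (X (- b)).
  by move=> rb; apply: (scalerI (norm0 b rb)); rewrite thHXN // thXNH.
have thXX b c : roots H b -> roots H c -> c <> - b -> theta (X b) (X c) = 0.
  move=> rb rc cNb; have [<-|bc] := pselect (b = c); last first.
    rewrite (determined_roots gS Hc Bf HX actL thE th_HX
      (root_vectorX HX rb) (root_vectorX HX rc)) //.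
    - exact: root_neq0 rb.
    - exact: root_neq0 rc.
    by move=> E; apply: cNb; rewrite E opprK.
  have := equi_act thE (X b) (vsval (root_dual b)) (X b).
  rewrite thHX // act0 liexx (bilin0r thE) addr0 (lieX_cartan HX) // (bilinNl thE) (bilinZl thE).
  move/esym/eqP; rewrite oppr_eq0 scaler_eq0 => /orP[|/eqP//].
  by rewrite (negPf (norm0 b rb)).
have thC x y : theta x y = theta y x.
  apply/eqP; rewrite -subr_eq0; apply/eqP.
  pose d x y := theta x y - theta y x.
  have dE : bilinear_map d.
    split=> [y' k u v|k u y' v]; rewrite /d.
      by rewrite (bilinDl thE) (bilinZl thE) (bilinDr thE) (bilinZr thE) scalerBr opprD addrACA.
    by rewrite (bilinDl thE) (bilinZl thE) (bilinDr thE) (bilinZr thE) scalerBr opprD addrACA.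
  apply: (bilinear_eq0 gS Hc Bf HX dE).
  - move=> h h'; move: h; apply: (root_dual_ind gS Hc Bf HX rankH) => [c k rc|h k]; last first.
      by rewrite linearD /d /= (bilinDl thE) (bilinDr thE) opprD addrACA => -> ->; rewrite addr0.
    have -> : vsval (k *: root_dual c) = k *: vsval (root_dual c) by exact: linearZ.
    by rewrite /d (bilinZl thE) (bilinZr thE) -thHXN // -thXNH // thN // subrr.
  - by move=> h a ra; rewrite /d thHX // thXH // subrr.
  - by move=> h a ra; rewrite /d thHX // thXH // subrr.
  move=> a b ra rb; rewrite /d.
  have [->|bNa] := pselect (b = - a); first by rewrite thN // subrr.
  rewrite !thXX // ?subrr // => E; apply: bNa.
  by rewrite E opprK.
pose d z x y := theta (lie z x) y + theta x (lie z y).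
have thHH0 z h h' : d z (vsval h) (vsval h') = 0.
  move: z; apply: (root_ind gS Hc Bf HX) => [k|a k ra|u v].
  - by rewrite /d !(lie_cartan Hc) (bilin0l thE) (bilin0r thE) addr0.
  - rewrite /d !lieZl !(lieX_cartan HX) // (bilinZl thE) (bilinNl thE) (bilinZl thE) thXH //.
    by rewrite (bilinZr thE) (bilinNr thE) (bilinZr thE) thHX // !scaler0 oppr0 scaler0 addr0.
  by rewrite /d !lieDl (bilinDl thE) (bilinDr thE) addrACA => -> ->; rewrite addr0.
(* On [H] this is [thHH0]; on opposite root vectors [thXNH] reduces to values on [H]; all other
   values of [theta] are 0. *)
have inv z x y : act z (theta x y) = 0.
  move: x y; pose f x y := act z (theta x y).
  have aD p q : act z (p + q) = act z p + act z q.
    by have := actL z 1 p q; rewrite !scale1r.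
  have aZ k p : act z (k *: p) = k *: act z p.
    by have := actL z k p 0; rewrite !addr0 act0 addr0.
  have fE : bilinear_map f.
    split=> [v k u u'|u k v v']; rewrite /f.
      by rewrite (bilinDl thE) (bilinZl thE) aD aZ.
    by rewrite (bilinDr thE) (bilinZr thE) aD aZ.
  have fHH h h' : f (vsval h) (vsval h') = 0 by rewrite /f (equi_act thE) -/(d _ _ _) thHH0.
  apply: (bilinear_eq0 gS Hc Bf HX fE) => //.
  - by move=> h a ra; rewrite /f thHX.
  - by move=> h a ra; rewrite /f thXH.
  move=> a b ra rb; rewrite /f; have [->|bNa] := pselect (b = - a); last by rewrite thXX.
  apply: (scalerI (norm0 a ra)); rewrite -aZ thXNH // scaler0; exact: fHH.
(* Since [y] acts by 0 on [theta x z], equivariance becomes associativity of [theta]. *)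
exists T, theta; split=> // x y z.
have := equi_act thE y x z; rewrite inv lieC (bilinNl thE) => /esym/eqP.
by rewrite addrC subr_eq0 => /eqP.
Qed.

End Decomposition.

(** * Current algebras *)

Lemma perfect_ind (K : numFieldType) (g : finLieAlgType K) (P : g -> Prop) :
  (forall z : g, exists s : seq (g * g), z = \sum_(p <- s) lie p.1 p.2) ->
  P 0 -> (forall x y, P x -> P y -> P (x + y)) -> (forall x y, P (lie x y)) -> forall z, P z.
Proof.
by move=> perf P0 PD PL z; have [s ->] := perf z; elim/big_rec: _ => // p x _; apply: PD.
Qed.

Section Tower.
Variables (K : numFieldType) (g : finLieAlgType K) (H : {vspace g}).
Variables (B : g -> g -> K) (X : 'Hom(subvs_of H, K^o) -> g).
Implicit Types (x y z : g).
Hypotheses (gS : simple_lie g) (Hc : cartan_subalgebra H) (Bf : invariant_form B).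
Hypotheses (HX : normalized_root_vectors B X) (rankH : (3 <= \dim H)%N).

Variables (L : lieAlgType K) (iota kappa kappa2 : {linear g -> L}).
Hypothesis iota_lie : forall x y, lie (iota x) (iota y) = iota (lie x y).
Hypothesis kappa_act : forall x y, lie (iota x) (kappa y) = kappa (lie x y).
Hypothesis kappa_lie : forall x y, lie (kappa x) (kappa y) = kappa2 (lie x y).

Let perfect z : exists s : seq (g * g), z = \sum_(p <- s) lie p.1 p.2.
Proof. exact: simple_perfect gS z. Qed.

Section Step.
Variables (k : nat -> {linear g -> L}) (N : nat).
Hypothesis N_gt0 : (0 < N)%N.
Hypotheses (k0 : k 0 =1 iota) (k1 : k 1 =1 kappa).
Hypothesis k_lie : forall i j x y, (i + j <= N)%N -> lie (k i x) (k j y) = k (i + j)%N (lie x y).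

Variables (T : {linear g -> L}) (theta : g -> g -> L).
Hypothesis T_act : forall x y, lie (iota x) (T y) = T (lie x y).
Hypotheses (thE : bilinear_map theta) (thC : forall x y, theta x y = theta y x).
Hypothesis thA : forall x y z, theta (lie x y) z = theta x (lie y z).
Hypothesis kN : forall x y, lie (kappa x) (k N y) = T (lie x y) + theta x y.

(** For [x = lie u v], write [k i.+2 x] as a bracket of degrees 1 and [i.+1] and apply the Jacobi
    identity. The first double bracket contributes one [theta], by [kN]; the second contributes
    [i.+1] of them, with the same sign after associativity. *)
Lemma tower_defect i x y : (i < N)%N ->
  lie (k i.+1 x) (k (N - i)%N y) = T (lie x y) + i.+1%:R *: theta x y.
Proof.
elim: i x y => [|i IHi] x y lt_iN; first by rewrite subn0 k1 kN scale1r.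
move: x; apply: (perfect_ind perfect) => [|x x' xE x'E|u v].
- by rewrite linear0 !lie0l linear0 (bilin0l thE) scaler0 addr0.
- by rewrite linearD !lieDl xE x'E linearD (bilinDl thE) scalerDr addrACA.
have jacobi a b c : lie (lie a b) c = lie a (lie b c) - lie b (lie a c) :> L.
  by rewrite (lie_derivation a b c) addrK.
have -> : k i.+2 (lie u v) = lie (k 1 u) (k i.+1 v) by rewrite k_lie.
rewrite jacobi (k_lie (i := i.+1)); last by rewrite subnKC // ltnW.
rewrite (k_lie (i := 1) (j := (N - i.+1)%N)); last by rewrite add1n subnSK ?leq_subr // ltnW.
have -> : (i.+1 + (N - i.+1))%N = N by lia.
have -> : (1 + (N - i.+1))%N = (N - i)%N by lia.
rewrite k1 kN.
rewrite IHi; last exact: ltnW.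
have -> : lie (lie u v) y = lie u (lie v y) - lie v (lie u y).
  by rewrite (lie_derivation u v y) addrK.
rewrite linearB -thA -(thA v) (lieC v u) (bilinNl thE) scalerN opprD opprK addrACA.
by rewrite -[i.+2%:R]natr1 scalerDl scale1r [theta _ _ + _]addrC.
Qed.

(* [k_N] and [k_1] swapped: the defect [theta] of [(1, N)] and the defect
   [N theta] of [(N, 1)] must be opposite. *)
Lemma tower_defect_eq0 x y : theta x y = 0.
Proof.
have ltN : (N.-1 < N)%N by rewrite prednK.
have := tower_defect x y ltN; rewrite prednK // (_ : (N - N.-1)%N = 1%N) ?k1; last by lia.
rewrite lieC kN lieC linearN opprD opprK thC => /addrI/eqP.
rewrite eq_sym -addr_eq0 -[X in _ + X]scale1r -scalerDl natr1 scaler_eq0 pnatr_eq0.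
by rewrite thC => /eqP.
Qed.

Lemma tower_step i j x y : k N.+1 =1 T -> (i + j <= N.+1)%N ->
  lie (k i x) (k j y) = k (i + j)%N (lie x y).
Proof.
move=> kT; rewrite leq_eqVlt => /orP[/eqP ij|]; last exact: k_lie.
rewrite ij kT; case: i ij => [|i] ij.
  by rewrite k0 -(_ : N.+1 = j) // kT T_act.
have [lt_iN|le_Ni] := ltnP i N.
  rewrite (_ : j = (N - i)%N) ?tower_defect ?tower_defect_eq0 ?scaler0 ?addr0 //.
  by rewrite -[N]/(N.+1.-1) -ij addSn /= addKn.
have [iN j0] : i = N /\ j = 0%N by lia.
by rewrite iN j0 k0 kT lieC T_act lieC linearN opprK.
Qed.

End Step.

Lemma current_tower : exists k : nat -> {linear g -> L},
  [/\ k 0 =1 iota, k 1 =1 kappa &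
      forall i j x y, lie (k i x) (k j y) = k (i + j)%N (lie x y)].
Proof.
have /choice[d dE] := perfect.
(* From degree 2 on, [kf] depends on a chosen expression of [z] as a sum of brackets, so its
   linearity is not evident. *)
pose fix kf (n : nat) (z : g) {struct n} : L :=
  match n with
  | 0 => iota z
  | n'.+1 => if n' == 0 then kappa z else \sum_(p <- d z) lie (kappa p.1) (kf n' p.2)
  end.
(* [k n] is a linear map that agrees with [kf n] once [kf n] is known to be linear; until then it
   may be the default [\0]. *)
have /choice[k kE] n : exists l : {linear g -> L}, linear (kf n) -> l =1 kf n.
  have [lin|] := pselect (linear (kf n)); last by exists \0.
  have kfL (f : g -> L) : linear f -> exists l : {linear g -> L}, l =1 f.
    by move=> fL; exists (HB.pack_for {linear g -> L} f (GRing.isLinear.Build K g L *:%R f fL)).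
  by have [l lE] := kfL _ lin; exists l.
have k0 : k 0 =1 iota by apply: kE => c x y; rewrite /= linearP.
have k1 : k 1 =1 kappa by apply: kE => c x y; rewrite /= linearP.
pose good N := k N =1 kf N /\ forall i j x y, (i + j <= N)%N ->
  lie (k i x) (k j y) = k (i + j)%N (lie x y).
suff allgood N : good N.+1.
  by exists k; split=> // i j x y; apply: (allgood (i + j)%N).2; apply: leqnSn.
have step n (T : {linear g -> L}) theta : good n.+1 ->
    (forall x y, lie (iota x) (T y) = T (lie x y)) -> bilinear_map theta ->
    (forall x y, theta x y = theta y x) ->
    (forall x y z, theta (lie x y) z = theta x (lie y z)) ->
    (forall x y, lie (kappa x) (k n.+1 y) = T (lie x y) + theta x y) -> good n.+2.
  move=> [kN kL] TA thE thC thA kNE.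
  have th0 := tower_defect_eq0 (ltn0Sn n) k1 kL thE thC thA kNE.
  have kfT : kf n.+2 =1 T.
    move=> z; have -> : kf n.+2 z = \sum_(p <- d z) lie (kappa p.1) (kf n.+1 p.2) by [].
    rewrite [in RHS](dE z) linear_sum; apply: eq_bigr => p _.
    by rewrite -kN kNE th0 addr0.
  have kT : k n.+2 =1 T.
    by move=> z; rewrite kE ?kfT // => c x y; rewrite !kfT linearP.
  split=> [z|i j x y ij]; first by rewrite kT kfT.
  exact: (tower_step (ltn0Sn n) k0 k1 kL TA thE thC thA kNE).
elim: N => [|N IHN].
  split=> // -[|[|i]] [|[|j]] x y //= _; rewrite ?k0 ?k1 ?iota_lie ?kappa_act //.
  by rewrite lieC kappa_act lieC linearN opprK.
have actL z : linear (fun v => lie (iota z) v) by apply: lie_linearr.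
case: N IHN => [|N] IHN.
  (* Degree 2 is given by [kappa2], with no defect; the decomposition theorem serves from degree 3
     on. *)
  apply: (step 0%N kappa2 (fun _ _ => 0)) => // [x y||x y].
  - move: y; apply: (perfect_ind perfect) => [|u v uE vE|u v].
    + by rewrite linear0 lie0r (raddf0 (lie x)) linear0.
    + by rewrite (lieDr x u v) !(linearD kappa2) /= (lieDr (iota x) (kappa2 u) (kappa2 v)) uE vE.
    by rewrite -(kappa_lie u v) (lie_derivation (iota x)) !kappa_act !kappa_lie
      (lie_derivation x u v) (linearD kappa2).
  - by split=> [y|x] t u u' /=; rewrite scaler0 addr0.
  by rewrite k1 kappa_lie addr0.
have [kN kL] := IHN.
pose phi x y := lie (kappa x) (k N.+2 y).
have phiE : equivariant (fun z v => lie (iota z) v) phi.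
  split=> [|z x y]; first split=> [y c x x'|x c y y'].
  - by rewrite /phi linearP lieDl lieZl.
  - by rewrite /phi linearP lieDr lieZr.
  by rewrite /phi lie_derivation kappa_act -k0 kL.
(* Write the top degree of a bracket as a bracket of degree 1 with the degree below. Symmetry then
   holds because [kappa h] and [kappa h'] commute. *)
have phiH (h h' : subvs_of H) z :
    phi (vsval h) (lie (vsval h') z) = phi (vsval h') (lie (vsval h) z).
  rewrite /phi -!(kL 1%N N.+1) // !k1 lie_derivation kappa_lie.
  by rewrite (lie_cartan Hc) linear0 lie0l add0r.
have [T [theta [TA thE thC thA thD]]] :=
  equivariant_decomposition gS Hc Bf HX rankH actL phiE phiH.
exact: (step N.+1 T theta IHN TA thE thC thA thD).
Qed.

End Tower.

(** * Associative algebras under the commutator *)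

Section CommutatorLie.
Variables (K : comNzRingType) (A : algType K).

(** A copy of [A] to carry the commutator bracket, so that results on Lie algebras apply inside
    associative algebras. *)
Definition commutator_algebra : Type := A.
HB.instance Definition _ := GRing.Lmodule.on commutator_algebra.

Fact commutator_linearl (b : A) : linear (fun a : A => commutator a b).
Proof.
move=> k x y; rewrite /commutator mulrDl mulrDr opprD addrACA scalerBr.
by rewrite -scalerAl -scalerAr.
Qed.

Fact commutator_linearr (b : A) : linear (commutator b).
Proof.
move=> k x y; rewrite /commutator mulrDl mulrDr opprD addrACA scalerBr.
by rewrite -scalerAl -scalerAr.
Qed.

Fact commutatorxx (a : A) : commutator a a = 0.
Proof. exact: subrr. Qed.

Fact commutator_jacobi (a b c : A) :
  commutator a (commutator b c) + commutator b (commutator c a) +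
  commutator c (commutator a b) = 0.
Proof.
rewrite /commutator !mulrBl !mulrBr !mulrA !opprB.
set u1 := a * b * c; set u2 := a * c * b; set u3 := b * c * a; set u4 := c * b * a.
set u5 := b * a * c; set u6 := c * a * b.
have E : u1 - u2 + (u4 - u3) + (u3 - u5 + (u2 - u6)) = - (u6 - u4 + (u5 - u1)).
  rewrite [u3 - u5 + _]addrC addrACA !subrKA opprD !opprB [LHS]addrC addrACA [RHS]addrACA.
  by rewrite [- u5 - u6]addrC.
by rewrite E addNr.
Qed.

HB.instance Definition _ := Lmodule_isLie.Build K commutator_algebra
  commutator_linearl commutator_linearr commutatorxx commutator_jacobi.

End CommutatorLie.

(** * Towers of linear maps as maps out of the current algebra *)

Section Extension.
Variables (K : comNzRingType) (g : lieAlgType K) (A : algType {poly K}).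
Local Notation L := (commutator_algebra (restricted A)).

Lemma tower_extends (k : nat -> {linear g -> L}) :
  (forall i j x y, lie (k i x) (k j y) = k (i + j)%N (lie x y)) ->
  extends_to_current (k 0 : g -> A) (k 1 : g -> A).
Proof.
move=> kL; have bound (c : current g) : exists N, forall n, (N <= n)%N -> c n = 0.
  by case: c => c0 c0fin; exact/asboolP.
have {bound} [N NE] := choice bound.
pose F (c : current g) : L := \sum_(j < N c) k j (c j).
(* The bound [N c] is an arbitrary choice; any other bound on the support gives the same sum, which
   is what linearity requires. *)
have FE n (c : current g) : (forall m, (n <= m)%N -> c m = 0) -> F c = \sum_(j < n) k j (c j).
  move=> c0; pose M := maxn n (N c).
  have widen m : (m <= M)%N -> (forall j, (m <= j)%N -> c j = 0) ->
      \sum_(j < m) k j (c j) = \sum_(j < M) k j (c j).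
    move=> le_mM cm; rewrite (big_ord_widen M (fun j => k j (c j)) le_mM) big_mkcond.
    by apply: eq_bigr => j _; case: ltnP => // /cm ->; rewrite linear0.
  by rewrite /F (widen (N c)) ?leq_maxr ?(widen n) ?leq_maxl //; apply: NE.
have Flin : linear F.
  move=> t c d; pose M := maxn (N c) (N d).
  have cM m : (M <= m)%N -> c m = 0 by rewrite geq_max => /andP[/NE].
  have dM m : (M <= m)%N -> d m = 0 by rewrite geq_max => /andP[_ /NE].
  have tcd m : (t *: c + d) m = t *: c m + d m by [].
  rewrite (FE M (t *: c + d)) ?(FE M c) ?(FE M d) // => [|m le_m]; last first.
    by rewrite tcd cM // dM // scaler0 addr0.
  rewrite scaler_sumr -big_split; apply: eq_bigr => j _.
  by rewrite tcd linearP.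
pose FL : {linear current g -> L} := HB.pack F (GRing.isLinear.Build K (current g) L *:%R F Flin).
have Fmono n x : FL (monomial n x) = k n x.
  rewrite [LHS](FE n.+1) => [|m lt_nm] /=; last by rewrite gtn_eqF.
  rewrite big_ord_recr /= eqxx big1 ?add0r // => i _.
  by rewrite ltn_eqF ?linear0.
have [||phi phiE] := @env_lift K (current g) A F; first exact: Flin.
  move=> c d; rewrite -[LHS]/(FL (lie c d)) -[RHS]/(lie (FL c) (FL d)).
  have FS (e : current g) : FL e = \sum_(j < N e) k j (e j) by [].
  rewrite [in RHS]FS [in RHS](FS d) {1}(current_sum (NE c)) lie_suml [LHS]linear_sum lie_suml.
  apply: eq_bigr => i _; rewrite {1}(current_sum (NE d)) lie_sumr [LHS]linear_sum lie_sumr.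
  by apply: eq_bigr => j _; rewrite lie_monomial [LHS]Fmono kL.
exists phi => x; rewrite !phiE; split; exact: Fmono.
Qed.

Lemma extends_tower (iota kappa : g -> A) : extends_to_current iota kappa ->
  exists k : nat -> {linear g -> L}, [/\ k 0 =1 iota, k 1 =1 kappa &
    forall i j x y, lie (k i x) (k j y) = k (i + j)%N (lie x y)].
Proof.
case=> phi phiE.
pose k n (x : g) : L := phi (env_in (monomial n x)).
have kL n : linear (k n).
  move=> c x y; by rewrite /k !linearP.
exists (fun n => HB.pack_for {linear g -> L} (k n) (GRing.isLinear.Build K g L *:%R (k n) (kL n))).
split=> [x|x|i j x y] /=; [exact: (phiE x).1|exact: (phiE x).2|].
by rewrite /k -lie_monomial env_in_lie /commutator rmorphB !rmorphM.
Qed.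

End Extension.

(** * The action on [Dlambda] *)

Lemma det_mx22 (R : comNzRingType) (M : 'M[R]_2) : \det M = M 0 0 * M 1 1 - M 0 1 * M 1 0.
Proof.
rewrite (expand_det_row _ ord0) big_ord_recl big_ord_recl big_ord0 addr0 /cofactor.
rewrite det_mx11 det_mx11 !mxE.
rewrite expr0 mul1r expr1 mulN1r mulrN.
congr (M _ _ * M _ _ - M _ _ * M _ _); apply: val_inj; by [].
Qed.

Section EquivariantConstructions.
Variables (K : fieldType) (g : lieAlgType K) (V : lmodType K) (act : g -> V -> V).
Hypothesis actL : forall z, linear (act z).

Lemma equivariantD (phi psi : g -> g -> V) : equivariant act phi -> equivariant act psi ->
  equivariant act (fun x y => phi x y + psi x y).
Proof.
move=> phiE psiE; split=> [|z x y]; first split=> [y t x x'|x t y y'].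
- by rewrite !(bilinDl phiE, bilinDl psiE, bilinZl phiE, bilinZl psiE) scalerDr addrACA.
- by rewrite !(bilinDr phiE, bilinDr psiE, bilinZr phiE, bilinZr psiE) scalerDr addrACA.
have := actL z 1 (phi x y) (psi x y); rewrite !scale1r => ->.
by rewrite (equi_act phiE) (equi_act psiE) addrACA.
Qed.

Lemma equivariantZ (t : K) (phi : g -> g -> V) : equivariant act phi ->
  equivariant act (fun x y => t *: phi x y).
Proof.
move=> phiE; split=> [|z x y]; first split=> [y u x x'|x u y y'].
- by rewrite (bilinDl phiE) (bilinZl phiE) scalerDr !scalerA mulrC.
- by rewrite (bilinDr phiE) (bilinZr phiE) scalerDr !scalerA mulrC.
have act0 : act z 0 = 0 by have := actL z (-1) 0 0; rewrite !scaleN1r oppr0 addr0 addNr.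
have := actL z t (phi x y) 0; rewrite !addr0 act0 addr0 => ->.
by rewrite (equi_act phiE) scalerDr.
Qed.

Lemma equivariant_comp (T : {linear g -> V}) : (forall z x, act z (T x) = T (lie z x)) ->
  equivariant act (fun x y => T (lie x y)).
Proof.
move=> TE; split=> [|z x y]; first split=> [y u x x'|x u y y'].
- by rewrite lieDl lieZl linearP.
- by rewrite lieDr lieZr linearP.
by rewrite TE lie_derivation linearD.
Qed.

End EquivariantConstructions.

Lemma equivariant_lie (K : fieldType) (g L : lieAlgType K) (iota al be : {linear g -> L}) :
  (forall x y, lie (iota x) (al y) = al (lie x y)) ->
  (forall x y, lie (iota x) (be y) = be (lie x y)) ->
  equivariant (fun z v => lie (iota z) v) (fun x y => lie (al x) (be y)).
Proof.
move=> alE beE; split=> [|z x y]; first split=> [y u x x'|x u y y'].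
- by rewrite linearP lieDl lieZl.
- by rewrite linearP lieDr lieZr.
by rewrite lie_derivation alE beE.
Qed.

(** * The transformed generators and their relations *)

Section SL2Assignment.
Variables (K : numFieldType) (g : finLieAlgType K) (H : {vspace g}).
Variables (B : g -> g -> K) (X : 'Hom(subvs_of H, K^o) -> g).
Local Notation weight := 'Hom(subvs_of H, K^o).
Implicit Types (b c : weight) (x y z : g).
Hypotheses (gS : simple_lie g) (Hc : cartan_subalgebra H) (Bf : invariant_form B).
Hypotheses (HX : normalized_root_vectors B X) (rankH : (3 <= \dim H)%N).

Variables (A : algType {poly K}) (f : dgen g -> A).
Hypothesis hf : d_holds B X f.
Local Notation L := (commutator_algebra (restricted A)).

Definition lambda_term b1 b2 : A :=
  (4^-1 *: 'X : {poly K}) *: (\sum_(a <- fset_set (roots H))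
      anticommutator (f (GenX (lie (X b1) (X a)))) (f (GenX (lie (X (- a)) (X b2)))))
  - ((dual_form B b1 b2 / 4) *: 'X : {poly K}) *:
      anticommutator (f (GenX (X b1))) (f (GenX (X b2))).

Lemma anticommutatorC (a b : A) : anticommutator a b = anticommutator b a.
Proof. exact: addrC. Qed.

Variables (k q : nat -> {linear g -> L}) (p : {linear g -> L}).
Hypotheses (k0 : k 0 =1 f \o @GenX g) (q0 : q 0 =1 f \o @GenX g).
Hypotheses (k1 : k 1 =1 f \o @GenK g) (q1 : q 1 =1 f \o @GenQ g).
Hypothesis k_lie : forall i j x y, lie (k i x) (k j y) = k (i + j)%N (lie x y).
Hypothesis q_lie : forall i j x y, lie (q i x) (q j y) = q (i + j)%N (lie x y).
Hypothesis pE : p =1 f \o @GenP g.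

Let q0k y : q 0 y = k 0 y. Proof. by rewrite q0 k0. Qed.

(** Reindexing the sum by [a |-> - a] exchanges the two entries of each anticommutator, up to two
    signs that cancel. *)
Lemma lambda_term_sym b1 b2 : lambda_term b1 b2 = lambda_term b2 b1.
Proof.
rewrite /lambda_term /dual_form (form_sym Bf) anticommutatorC; congr (_ *: _ - _).
have NE x : f (GenX (- x)) = - f (GenX x).
  by rewrite -[LHS]/((f \o @GenX g) (- x)) -k0 linearN k0.
have finR := @finite_roots K g H.
rewrite [LHS](perm_big [seq - a | a <- fset_set (roots H)]) /=; last first.
  apply: uniq_perm; rewrite ?map_inj_uniq ?fset_uniq //.
  move=> a; apply/idP/mapP => [/mem_roots ra|[c /mem_roots rc ->]].
    by exists (- a); rewrite ?opprK //; apply/roots_mem/(roots_opp Hc Bf).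
  exact/roots_mem/(roots_opp Hc Bf).
rewrite big_map; apply: eq_bigr => a _.
rewrite opprK lieC NE (lieC (X a)) NE anticommutatorC.
by rewrite /anticommutator !mulrNN.
Qed.

Lemma kq_relation b1 b2 : roots H b1 -> roots H b2 -> b1 <> - b2 ->
  lie (k 1 (X b1)) (q 1 (X b2)) = p (lie (X b1) (X b2)) + (lambda_term b1 b2 : L).
Proof.
case: hf => _ _ _ _ rel r1 r2 b12; rewrite k1 q1 pE.
rewrite -[LHS]/(commutator (f (GenK (X b1))) (f (GenQ (X b2)))) rel //.
by rewrite /lambda_term /= addrAC addrA.
Qed.

Lemma p_act x y : lie (k 0 x) (p y) = p (lie x y).
Proof. by rewrite k0 !pE; case: hf => _ _ _ pact _; apply: pact. Qed.

Lemma kq_skew y w : lie (k 1 y) (q 1 w) + lie (q 1 y) (k 1 w) = 2 *: p (lie y w).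
Proof.
pose phi (y w : g) : L := lie (k 1 y) (q 1 w) + lie (q 1 y) (k 1 w) + (-2) *: p (lie y w).
suff : phi y w = 0 by rewrite /phi scaleNr => /eqP; rewrite subr_eq0 => /eqP.
pose act (z : g) (v : L) : L := lie (k 0 z) v.
have actL z : linear (act z) by apply: lie_linearr.
have kE (x u : g) : lie (k 0 x) (k 1 u) = k 1 (lie x u) by rewrite k_lie.
have qE (x u : g) : lie (k 0 x) (q 1 u) = q 1 (lie x u) by rewrite -q0k q_lie.
have phiE : equivariant act phi.
  apply: equivariantD => //; first apply: equivariantD => //.
  - exact: (equivariant_lie (iota := k 0)).
  - exact: (equivariant_lie (iota := k 0)).
  apply: equivariantZ => //; apply: equivariant_comp; exact: p_act.
apply: (skew_equivariant_eq0 gS Hc Bf HX rankH actL phiE).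
- move=> x u; rewrite /phi (lieC (k 1 x) (q 1 u)) (lieC (q 1 x) (k 1 u)) (lieC x u).
  by rewrite linearN scalerN -!opprD [_ + lie (k 1 u) _]addrC.
move=> b c rb rc bc; rewrite /phi kq_relation // (lieC (q 1 _)) kq_relation //; last first.
  by move=> E; apply: bc; rewrite E opprK.
rewrite (lambda_term_sym c) (lieC (X c)) linearN opprD opprK addrACA subrr addr0.
by rewrite -mulr2n -scaler_nat scaleNr subrr.
Qed.


(** By [kq_skew] the mixed terms in the bracket of [u K y + v Q y] with [u K w + v Q w] add up to
    [2 u v P (lie y w)]. The bracket thus depends only on [lie y w], as [current_tower] requires. *)
Lemma pencil_extends (u v : K) :
  extends_to_current (f \o @GenX g) (fun z => u%:P *: f (GenK z) + v%:P *: f (GenQ z)).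
Proof.
have [||z w|t [t0 t1 tL]] := @current_tower K g H B X gS Hc Bf HX rankH L (k 0)
    (u \*: k 1 \+ v \*: q 1 : {linear g -> L})
    ((u ^+ 2 \*: k 2 \+ v ^+ 2 \*: q 2) \+ (u * v) \*: (2 \*: p) : {linear g -> L}).
- by move=> y z; rewrite k_lie.
- move=> y z /=; rewrite lieDr !lieZr k_lie.
  by rewrite -[k 0 y]q0k q_lie.
- rewrite /= -kq_skew !lieDl !lieDr !lieZl !lieZr k_lie q_lie !scalerA -!expr2.
  move: (lie (k 1 z) (q 1 w)) (lie (q 1 z) (k 1 w)) => s1 s2.
  by rewrite [v * u]mulrC [_ *: s2 + _]addrC addrACA scalerDr.
have [phi phiE] := tower_extends tL.
by exists phi => x; rewrite (phiE x).1 (phiE x).2 t0 t1 k0 /= k1 q1.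
Qed.

(** [k 2 z] and [q 2 z] are the linear extensions of the commutators of [K y], [K w] and of [Q y],
    [Q w] for [z = lie y w]; they avoid a choice of [y] and [w]. *)
Definition sl2_assignment (M : 'M[K]_2) (d : dgen g) : A :=
  match d with
  | GenX z => f (GenX z)
  | GenK z => (M 0 0)%:P *: f (GenK z) + (M 0 1)%:P *: f (GenQ z)
  | GenQ z => (M 1 1)%:P *: f (GenQ z) + (M 1 0)%:P *: f (GenK z)
  | GenP z => (M 0 0 * M 1 1 + M 0 1 * M 1 0)%:P *: f (GenP z)
      + (M 0 0 * M 1 0)%:P *: (k 2 z : A) + (M 0 1 * M 1 1)%:P *: (q 2 z : A)
  end.

Lemma sl2_assignment_holds M : M \in SL2 K -> d_holds B X (sl2_assignment M).
Proof.
move=> M1; split.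
- exact: pencil_extends.
- have [phi phiE] := pencil_extends (M 1 0) (M 1 1).
  by exists phi => x; rewrite (phiE x).1 (phiE x).2 /= [(M 1 0)%:P *: _ + _]addrC.
- move=> t y z /=.
  have pD : f (GenP (t *: y + z)) = t%:P *: f (GenP y) + f (GenP z).
    by have := linearP p t y z; rewrite !pE.
  have kD n : (k n (t *: y + z) : A) = t%:P *: (k n y : A) + k n z.
    exact: linearP.
  have qD n : (q n (t *: y + z) : A) = t%:P *: (q n y : A) + q n z.
    exact: linearP.
  rewrite pD kD qD !scalerDr !scalerA ![_%:P * t%:P]mulrC -!scalerA.
  by rewrite [RHS]addrACA (addrACA (t%:P *: (_ *: f (GenP y)))).
- move=> y z; pose F : L := (M 0 0 * M 1 1 + M 0 1 * M 1 0) *: p z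
    + (M 0 0 * M 1 0) *: k 2 z + (M 0 1 * M 1 1) *: q 2 z.
  have -> : sl2_assignment M (GenP z) = F by rewrite /F pE.
  have -> : sl2_assignment M (GenX y) = k 0 y by rewrite k0.
  rewrite -[LHS]/(lie (k 0 y) F) /F !lieDr !lieZr p_act k_lie -q0k q_lie /=.
  by rewrite pE.
move=> b1 b2 r1 r2 b12.
pose S : L := lambda_term b1 b2.
set l := lie (X b1) (X b2).
transitivity ((M 0 0 * M 1 1 + M 0 1 * M 1 0) *: p l
    + (M 0 0 * M 1 0) *: k 2 l + (M 0 1 * M 1 1) *: q 2 l + S); last first.
  by rewrite /S /lambda_term /= pE -/l addrA addrAC.
have -> : sl2_assignment M (GenK (X b1)) = M 0 0 *: k 1 (X b1) + M 0 1 *: q 1 (X b1) :> L.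
  by rewrite k1 q1.
have -> : sl2_assignment M (GenQ (X b2)) = M 1 1 *: q 1 (X b2) + M 1 0 *: k 1 (X b2) :> L.
  by rewrite k1 q1.
rewrite -[LHS]/(lie (M 0 0 *: k 1 (X b1) + M 0 1 *: q 1 (X b1) : L)
  (M 1 1 *: q 1 (X b2) + M 1 0 *: k 1 (X b2) : L)).
rewrite !lieDl !lieDr !lieZl !lieZr k_lie q_lie kq_relation //.
(* In the bracket of [Q] with [K] the [P] term keeps its sign and the symmetric [lambda] term
   changes sign. *)
rewrite (lieC (q 1 _)) kq_relation //; last first.
  by move=> E; apply: b12; rewrite E opprK.
(* The [lambda] term therefore comes out multiplied by the determinant of [M], which is 1. *)
have Sdet : S = (M 0 0 * M 1 1 - M 0 1 * M 1 0) *: S.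
  by move: M1; rewrite /SL2 unfold_in det_mx22 => /eqP ->; rewrite scale1r.
rewrite (lambda_term_sym b2) (lieC (X b2)) (linearN p) -/S -/l [in RHS]Sdet {Sdet}.
move: S (p l) (k 2 l : L) (q (1 + 1)%N l : L) => s0 u v w.
rewrite opprD opprK !scalerDr !scalerDl !scalerN !scaleNr !scalerA.
by rewrite [LHS](AC ((2 * 1) * (1 * 2)) ((1 * 5) * 3 * 4 * (2 * 6))).
Qed.

End SL2Assignment.

(** * Specialization at lambda = 0 *)

Section ConstantTermAlgebra.
Variables (K : comNzRingType) (E : algType K).

(* [E] as a [{poly K}]-algebra on which ['X] acts by 0. *)
Definition constant_term_algebra : Type := E.
HB.instance Definition _ := GRing.NzRing.on constant_term_algebra.

Definition constant_term_scale (c : {poly K}) (x : constant_term_algebra) :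
  constant_term_algebra := (c.[0] *: (x : E) : E).

Fact constant_term_scaleA a b x :
  constant_term_scale a (constant_term_scale b x) = constant_term_scale (a * b) x.
Proof. by rewrite /constant_term_scale scalerA hornerM. Qed.
Fact constant_term_scale1 : left_id 1 constant_term_scale.
Proof. by move=> x; rewrite /constant_term_scale hornerC scale1r. Qed.
Fact constant_term_scaleDr : right_distributive constant_term_scale +%R.
Proof. by move=> c x y; rewrite /constant_term_scale scalerDr. Qed.
Fact constant_term_scaleDl x : {morph constant_term_scale^~ x : a b / a + b}.
Proof. by move=> a b; rewrite /constant_term_scale hornerD scalerDl. Qed.
HB.instance Definition _ := GRing.Zmodule_isLmodule.Build {poly K} constant_term_algebra
  constant_term_scaleA constant_term_scale1 constant_term_scaleDr constant_term_scaleDl.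

Fact constant_term_scaleAl (c : {poly K}) (x y : constant_term_algebra) :
  c *: (x * y) = (c *: x) * y.
Proof. exact: (@scalerAl K E). Qed.
HB.instance Definition _ := GRing.Lmodule_isLalgebra.Build {poly K} constant_term_algebra
  constant_term_scaleAl.
Fact constant_term_scaleAr (c : {poly K}) (x y : constant_term_algebra) :
  c *: (x * y) = x * (c *: y).
Proof. exact: (@scalerAr K E). Qed.
HB.instance Definition _ := GRing.Lalgebra_isAlgebra.Build {poly K} constant_term_algebra
  constant_term_scaleAr.

Lemma constant_termZX (t : K) (x : constant_term_algebra) :
  (t *: 'X : {poly K}) *: x = 0.
Proof.
by rewrite -[LHS]/(constant_term_scale _ x) /constant_term_scale hornerZ hornerX mulr0 scale0r.
Qed.

End ConstantTermAlgebra.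

Import passmx.

(** * Nonvanishing of [K] in the presented algebra *)

Section Nontriviality.
Variables (K : fieldType) (g : finLieAlgType K) (H : {vspace g}).
Variables (B : g -> g -> K) (X : 'Hom(subvs_of H, K^o) -> g).

(* A representation of [g] yields a module over [g[v]] by [v |-> 1]; with
   [Q = P = 0] and [lambda = 0] this is a module over [Dlambda]. *)
Lemma dK_neq0_of_algebra (E : algType K) (r : g -> E) (z : g) : linear r ->
  (forall x y, r (lie x y) = commutator (r x) (r y)) -> r z <> 0 -> dK B X z <> 0.
Proof.
move=> rL rM rz; pose A : algType {poly K} := constant_term_algebra E.
pose f (d : dgen g) : A := match d with GenX z => r z | GenK z => r z | _ => 0 end.
have rL' : linear (r : g -> commutator_algebra (restricted A)).
  move=> c x y; rewrite rL; congr (_ + _).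
  by rewrite -[RHS]/(constant_term_scale c%:P (r x)) /constant_term_scale hornerC.
pose rr : {linear g -> commutator_algebra (restricted A)} :=
  HB.pack_for {linear g -> commutator_algebra (restricted A)}
    (r : g -> commutator_algebra (restricted A))
    (GRing.isLinear.Build K g (commutator_algebra (restricted A)) *:%R _ rL').
have hf : d_holds B X f.
  split.
  - apply: (@tower_extends K g A (fun _ => rr)) => i j x y.
    by rewrite /= rM.
  - apply: (@tower_extends K g A (fun n => if n is 0 then rr else \0)) => -[|i] [|j] x y /=.
    + by rewrite rM.
    + by rewrite lie0r.
    + by rewrite lie0l.
    by rewrite lie0l.
  - by move=> a x y; rewrite /= scaler0 addr0.
  - by move=> x y; rewrite /commutator mulr0 mul0r subrr.
  move=> b1 b2 _ _ _; rewrite /= !constant_termZX /commutator mulr0 mul0r.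
  by rewrite !subrr add0r.
move=> kz; apply: rz; have := congr1 (lift (P := d_presentation B X) hf) kz.
by rewrite lift_gen raddf0.
Qed.

Lemma dK_neq0_of_matrix n (r : g -> 'M[K]_n) (z : g) : linear r ->
  (forall x y, r (lie x y) = r x *m r y - r y *m r x) -> r z <> 0 -> dK B X z <> 0.
Proof.
(* Square matrices form a nonzero ring only in positive size; in size 0 the hypothesis on [r z]
   fails. *)
case: n r => [|n] r rL rM rz; first by case: rz; apply: flatmx0.
exact: (dK_neq0_of_algebra (E := 'M[K]_n.+1)) rL rM rz.
Qed.

Lemma dK_nontrivial : simple_lie g -> exists z, dK B X z <> 0.
Proof.
case=> -[x [y xy]] _; exists x.
pose e := vbasis (fullv : {vspace g}); have eB : basis_of fullv e by apply: vbasisP.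
(* The sign compensates for [mxof], which acts on row vectors and so reverses the order of
   composition. *)
pose ad (z : g) : 'End(g) := - linfun (lie z).
have adE z w : ad z w = - lie z w by rewrite opp_lfunE lfunE.
apply: (dK_neq0_of_matrix (r := fun z => mxof e e (ad z))).
- move=> c a b; rewrite -linearP; congr (mxof e e _); apply/lfunP => w.
  by rewrite add_lfunE scale_lfunE !adE lieDl lieZl opprD scalerN.
- move=> a b; rewrite -!(mxof_comp e e eB) -linearB; congr (mxof e e _); apply/lfunP => w.
  rewrite adE add_lfunE [X in _ = _ + X]opp_lfunE !comp_lfunE !adE !lieNr !opprK.
  by rewrite (lie_derivation a b w) opprD addrCA subrr addr0.
move/eqP; rewrite (mxof_eq0 eB eB) => /eqP /lfunP/(_ y).
by rewrite adE zero_lfunE => /eqP; rewrite oppr_eq0 => /eqP.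
Qed.

End Nontriviality.

(** * The action of SL2 and the automorphism of order 4 *)

Section Action.
Variables (K : numFieldType) (g : finLieAlgType K) (H : {vspace g}).
Variables (B : g -> g -> K) (X : 'Hom(subvs_of H, K^o) -> g).
Hypotheses (gS : simple_lie g) (Hc : cartan_subalgebra H) (Bf : invariant_form B).
Hypotheses (HX : normalized_root_vectors B X) (rankH : (3 <= \dim H)%N).
Local Notation D := (Dlambda B X).
Local Notation dX := (dX B X).
Local Notation dK := (dK B X).
Local Notation dQ := (dQ B X).
Local Notation dP := (dP B X).

Lemma dP_linear : linear_for (polyC \; *:%R) dP.
Proof. by case: (d_holds_gen B X gS). Qed.

Lemma dKQ_skew y w :
  commutator (dK y) (dQ w) + commutator (dQ y) (dK w) = 2%:P *: dP (lie y w).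
Proof.
have hf := d_holds_gen B X gS; have [ek eq pL _ _] := hf.
have [k [k0 k1 kL]] := extends_tower ek; have [q [q0 q1 qL]] := extends_tower eq.
pose L := commutator_algebra (restricted D).
pose p : {linear g -> L} := HB.pack_for {linear g -> L} (dP : g -> L)
  (GRing.isLinear.Build K g L *:%R _ pL).
have := kq_skew gS Hc Bf HX rankH hf k0 q0 k1 q1 kL qL (p := p) (fun _ => erefl) y w.
by rewrite !k1 !q1.
Qed.

(* [P] is determined by [K] and [Q] through [dKQ_skew]. *)
Lemma Dlambda_hom_ext (F G : {lrmorphism D -> D}) :
  (forall z, F (dX z) = G (dX z)) -> (forall z, F (dK z) = G (dK z)) ->
  (forall z, F (dQ z) = G (dQ z)) -> F =1 G.
Proof.
move=> FX FK FQ.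
have FP z : F (dP z) = G (dP z).
  move: z; apply: (perfect_ind (simple_perfect gS)) => [|u v|y w].
  - have -> : dP 0 = 0.
      by have := dP_linear (-1) 0 0; rewrite /= scaler0 addr0 polyCN scaleN1r addNr.
    by rewrite (raddf0 F) (raddf0 G).
  - have -> : dP (u + v) = dP u + dP v by have := dP_linear 1 u v; rewrite /= !scale1r.
    by rewrite (raddfD F) (raddfD G) /= => -> ->.
  have P2 : dP (lie y w) = (2^-1)%:P *: (commutator (dK y) (dQ w) + commutator (dQ y) (dK w)).
    by rewrite dKQ_skew scalerA -polyCM mulVf ?pnatr_eq0 // scale1r.
  have homC (F' : {lrmorphism D -> D}) a b : F' (commutator a b) = commutator (F' a) (F' b).
    by rewrite /commutator rmorphB !rmorphM.
  by rewrite P2 (linearZ_LR F) (linearZ_LR G) /= (raddfD F) (raddfD G) /= !homC !FK !FQ.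
apply: presented_ind => [[]|c|x y xE yE|x y xE yE] //.
- by rewrite (linearZ_LR F) (linearZ_LR G) /= !rmorph1.
- by rewrite (raddfD F) (raddfD G) /= xE yE.
by rewrite (rmorphM F) (rmorphM G) /= xE yE.
Qed.

Definition sl2_spec (M : 'M[K]_2) (F : D -> D) : Prop :=
  [/\ forall z, F (dX z) = dX z,
      forall z, F (dK z) = (M 0 0)%:P *: dK z + (M 0 1)%:P *: dQ z,
      forall z, F (dQ z) = (M 1 1)%:P *: dQ z + (M 1 0)%:P *: dK z &
      forall y w, F (dP (lie y w)) =
        (M 0 0 * M 1 1 + M 0 1 * M 1 0)%:P *: dP (lie y w)
        + (M 0 0 * M 1 0)%:P *: commutator (dK y) (dK w)
        + (M 0 1 * M 1 1)%:P *: commutator (dQ y) (dQ w)].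

Lemma sl2_hom_exists M : M \in SL2 K -> exists F : {lrmorphism D -> D}, sl2_spec M F.
Proof.
move=> M1; have hf := d_holds_gen B X gS; have [ek eq pL _ _] := hf.
have [k [k0 k1 kL]] := extends_tower ek; have [q [q0 q1 qL]] := extends_tower eq.
pose L := commutator_algebra (restricted D).
pose p : {linear g -> L} := HB.pack_for {linear g -> L} (dP : g -> L)
  (GRing.isLinear.Build K g L *:%R _ pL).
have hM := sl2_assignment_holds gS Hc Bf HX rankH hf k0 q0 k1 q1 kL qL (p := p)
  (fun _ => erefl) M1.
exists (lift (P := d_presentation B X) hM); split=> [z|z|z|y w]; rewrite [LHS]lift_gen //=.
congr (_ + _ *: _ + _ *: _).
  by rewrite -(kL 1%N 1%N) !k1.
by rewrite -(qL 1%N 1%N) !q1.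
Qed.

Lemma mulmx22 (M N : 'M[K]_2) i j : (M *m N) i j = M i 0 * N 0 j + M i 1 * N 1 j.
Proof.
rewrite mxE big_ord_recl big_ord_recl big_ord0 addr0.
by congr (_ * _ + M i _ * N _ j); apply: val_inj.
Qed.

(** By [Dlambda_hom_ext] only [X], [K] and [Q] need comparing, so the formula for [P] never enters.
    The matrices multiply in the order opposite to composition, whence a right action. *)
Lemma sl2_hom_comp M N (F G E : {lrmorphism D -> D}) :
  sl2_spec M F -> sl2_spec N G -> sl2_spec (M *m N) E -> E =1 G \o F.
Proof.
move=> [FX FK FQ _] [GX GK GQ _] [EX EK EQ _].
have Glin s t (x y : D) : G (s%:P *: x + t%:P *: y) = s%:P *: G x + t%:P *: G y.
  by rewrite raddfD /= !(linearZ_LR G).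
apply: (Dlambda_hom_ext (G := G \o F : {lrmorphism D -> D})) => z /=.
- by rewrite FX GX EX.
- rewrite FK EK Glin GK GQ !mulmx22 !polyCD !polyCM !scalerDl !scalerDr !scalerA.
  by rewrite [X in _ = _ + X]addrC addrACA.
rewrite FQ EQ Glin GK GQ !mulmx22 !polyCD !polyCM !scalerDl !scalerDr !scalerA.
by rewrite [LHS](AC (2 * 2) ((2 * 4) * (3 * 1))).
Qed.

Lemma sl2_hom1 (F : {lrmorphism D -> D}) : sl2_spec 1%:M F -> F =1 id.
Proof.
move=> [FX FK FQ _]; apply: (Dlambda_hom_ext (G := idfun : {lrmorphism D -> D})) => z //=.
  by rewrite FK !mxE /= scale1r scale0r addr0.
by rewrite FQ !mxE /= scale1r scale0r addr0.
Qed.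

Theorem sl2_action : exists act : 'M[K]_2 -> {lrmorphism D -> D},
  right_SL2_action act /\ forall M, M \in SL2 K -> sl2_spec M (act M).
Proof.
have /choice[act actE] (M : 'M[K]_2) :
    exists F : {lrmorphism D -> D}, M \in SL2 K -> sl2_spec M F.
  have [/sl2_hom_exists[F FE]|_] := boolP (M \in SL2 K); first by exists F.
  (* Outside [SL2] the identity is a default value. *)
  by exists (idfun : {lrmorphism D -> D}).
exists act; split=> //.
have SL1 : 1%:M \in SL2 K by rewrite /SL2 unfold_in det1.
have SLM M N : M \in SL2 K -> N \in SL2 K -> M *m N \in SL2 K.
  by rewrite /SL2 !unfold_in det_mulmx => /eqP -> /eqP ->; rewrite mulr1.
have act1 : act 1%:M =1 id by apply: sl2_hom1; apply: actE.
have actM M N : M \in SL2 K -> N \in SL2 K -> act (M *m N) =1 act N \o act M.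
  by move=> M1 N1; apply: sl2_hom_comp (actE _ M1) (actE _ N1) (actE _ (SLM _ _ M1 N1)).
split=> // M M1.
have uM : M \in unitmx by move: M1; rewrite /SL2 !unfold_in => /eqP ->; apply: unitr1.
have VM : invmx M \in SL2 K.
  by move: M1; rewrite /SL2 !unfold_in det_inv => /eqP ->; rewrite invr1.
exists (act (invmx M)) => x.
  by rewrite -[LHS]/((act (invmx M) \o act M) x) -actM // mulmxV // act1.
by rewrite -[LHS]/((act M \o act (invmx M)) x) -actM // mulVmx // act1.
Qed.

Lemma quarter_turn : exists s : {lrmorphism D -> D},
  [/\ bijective s, has_order 4 s &
    forall z, [/\ s (dX z) = dX z, s (dK z) = - dQ z, s (dQ z) = dK z & s (dP z) = - dP z]].
Proof.
(* The matrix with rows [(0, -1)] and [(1, 0)]. *)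
pose M : 'M[K]_2 := \matrix_(i, j) (if i == j then 0 else if i == 0 then -1 else 1).
have M1 : M \in SL2 K by rewrite /SL2 unfold_in det_mx22 !mxE /= mulr0 mulN1r sub0r opprK.
have [s [sX sK sQ sP]] := sl2_hom_exists M1.
have {}sK z : s (dK z) = - dQ z.
  by rewrite sK !mxE /= scale0r add0r polyCN scaleN1r.
have {}sQ z : s (dQ z) = dK z by rewrite sQ !mxE /= scale0r add0r scale1r.
have {}sP z : s (dP z) = - dP z.
  move: z; apply: (perfect_ind (simple_perfect gS)) => [|u v|y w].
  - have -> : dP 0 = 0.
      by have := dP_linear (-1) 0 0; rewrite /= scaler0 addr0 polyCN scaleN1r addNr.
    by rewrite (raddf0 s) oppr0.
  - have -> : dP (u + v) = dP u + dP v by have := dP_linear 1 u v; rewrite /= !scale1r.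
    by rewrite (raddfD s) /= => -> ->; rewrite opprD.
  rewrite sP !mxE /= !mul0r mulr0 !mulN1r add0r !scale0r !addr0.
  by rewrite polyCN scaleN1r.
have s4 : (s \o s) \o (s \o s) =1 id.
  apply: (Dlambda_hom_ext (F := (s \o s) \o (s \o s) : {lrmorphism D -> D})
    (G := idfun : {lrmorphism D -> D})) => z /=; first by rewrite !sX.
    by rewrite sK (raddfN s) /= sQ (raddfN s) /= sK opprK sQ.
  by rewrite sQ sK (raddfN s) /= sQ (raddfN s) /= sK opprK.
(* The square of [s] negates every [dK z], and some [dK z] is nonzero in characteristic 0. *)
have s2 : ~ s \o s =1 id.
  have [z kz] := dK_nontrivial B X gS; move=> /(_ (dK z)) /=.
  rewrite sK (raddfN s) /= sQ => E; apply: kz; apply/eqP.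
  have : (2%:P : {poly K}) *: dK z = 0.
    by rewrite polyCD scalerDl !scale1r -{1}E addNr.
  move/(congr1 (fun v => (2^-1)%:P *: v)); rewrite scaler0 scalerA -polyCM mulVf ?pnatr_eq0 //.
  by rewrite scale1r => ->.
exists s; split=> //.
  by exists (s \o s \o s) => x; have := s4 x.
(* Exponent 2 is [s2] itself. If the first or the third power is trivial, [s] is the identity, using
   [s4] for the third, and so is its square. *)
split=> // -[|[|[|[|k]]]] // _ sk; apply: s2 => x /=.
  have E y : s y = y := sk y.
  by rewrite !E.
have E y : s y = y by rewrite -[RHS]s4; apply/esym/(sk (s y)).
by rewrite !E.
Qed.

End Action.

Theorem proposition8p1 (R : realType) (g : finLieAlgType R[i]) (H : {vspace g})
    (B : g -> g -> R[i]) (X : 'Hom(subvs_of H, R[i]^o) -> g) :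
  simple_lie g ->
  cartan_subalgebra H -> (3 <= \dim H)%N ->
  invariant_form B -> normalized_form H B ->
  normalized_root_vectors B X ->
  (exists act : 'M[R[i]]_2 -> {lrmorphism Dlambda B X -> Dlambda B X},
    right_SL2_action act /\
    forall A : 'M[R[i]]_2, A \in SL2 R[i] ->
      let a11 := A 0 0 in let a12 := A 0 1 in
      let a21 := A 1 0 in let a22 := A 1 1 in
      [/\ forall z, act A (dX B X z) = dX B X z,
          forall z, act A (dK B X z) = a11%:P *: dK B X z + a12%:P *: dQ B X z,
          forall z, act A (dQ B X z) = a22%:P *: dQ B X z + a21%:P *: dK B X z &
          forall y w, act A (dP B X (lie y w)) =
            (a11 * a22 + a12 * a21)%:P *: dP B X (lie y w)
            + (a11 * a21)%:P *: commutator (dK B X y) (dK B X w)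
            + (a12 * a22)%:P *: commutator (dQ B X y) (dQ B X w)]) /\
  (exists s : {lrmorphism Dlambda B X -> Dlambda B X},
    [/\ bijective s,
        has_order 4 s &
        forall z, [/\ s (dX B X z) = dX B X z,
                      s (dK B X z) = - dQ B X z,
                      s (dQ B X z) = dK B X z &
                      s (dP B X z) = - dP B X z]]).
Proof.
move=> gS Hc rankH Bf _ HX.
by split; [apply: sl2_action | apply: quarter_turn].
Qed.
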